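(* Let $y\in g^{-1}((0,\infty))$ be fixed and let $$\hat f(x)=g(x)-\psi(x)\frac{g'(x)}{\psi'(x)} .$$ If $\lim_{x\to b-}g(x)/\psi(x)=0$, then $J_y(x)=V_y(x)$ for all $x\in\mathcal I$. Moreover, if in addition $\hat f$ is nonnegative and nondecreasing on $[y,b)$ and $g'$ is lower semicontinuous on $[y,b)$, then $V_y$ is $r$-excessive for $X$.
   Context: Diffusion. $X=\{X_t;\,t\in[0,\xi)\}$ is a linear, time-homogeneous, regular diffusion on $\mathcal I=(a,b)\subset\mathbb R$ with possibly infinite lifetime $\xi$, drift coefficient $\mu:\mathcal I\to\mathbb R$ and volatility coefficient $\sigma:\mathcal I\to(0,\infty)$, both continuous. $X$ does not die inside $\mathcal I$; the boundaries $a,b$ are natural, entrance, exit or regular, a regular boundary being killing (the process is sent to a cemetery state $\partial\notin\mathcal I$ on hitting it). Functions on $\mathcal I$ are taken to vanish at $\partial$. $r>0$ is a constant, and $T\sim\mathrm{Exp}(r)$ is independent of $X$. $M_t=\sup\{X_s; s\in[0,t]\}$ is the running supremum. $\psi$ is the (unique up to a positive multiple) positive increasing fundamental solution of $\frac12\sigma^2u''+\mu u'-ru=0$ satisfying the boundary conditions of $X$, so that $\mathbb E_x[e^{-r\tau_z}]=\psi(x)/\psi(z)$ for $x\le z$, where $\tau_z=\inf\{t\ge0:X_t\ge z\}$. Payoff. $g:\mathcal I\to\mathbb R$ is continuous, $g^{-1}((0,\infty))=(x_g,b)\ne\emptyset$ for some $x_g\in\mathcal I$, $\mathbb E_x[\sup_{t\ge0}e^{-rt}g(X_t)]<\infty$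 for all $x\in\mathcal I$, and $g$ is twice continuously differentiable on $\mathcal I\setminus\mathcal P$, where $\mathcal P\subset\mathcal I$ is a finite set with $|g'(x\pm)|<\infty$ and $|g''(x\pm)|<\infty$ for $x\in\mathcal P$. At points $x\in\mathcal P$, $g'(x)$ is understood as the right-hand derivative $g'(x+)$. Functionals. For $y\in g^{-1}((0,\infty))$, $$V_y(x)=\mathbb E_x[e^{-r\tau_y}g(X_{\tau_y});\tau_y<\infty]=\begin{cases}g(x),&x\ge y,\\ \psi(x)\,g(y)/\psi(y),&x<y,\end{cases}$$ $$J_y(x)=\mathbb E_x\big[\hat f(M_T)\mathbf 1_{[y,b)}(M_T)\big]=\psi(x)\int_{x\vee y}^b\hat f(z)\frac{\psi'(z)}{\psi^2(z)}\,dz$$ (the integral being understood as improper at $b$). A nonnegative measurable $h$ is $r$-excessive for $X$ if $\mathbb E_x[e^{-rt}h(X_t)]\le h(x)$ for all $t\ge0$, $x\in\mathcal I$, and $\mathbb E_x[e^{-rt}h(X_t)]\to h(x)$ as $t\downarrow0$. *)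

(* Defs.v *)
From HB Require Import structures.
From mathcomp Require Export all_boot all_order all_algebra.
From mathcomp Require Export all_classical all_reals all_analysis.
From mathcomp Require Export measurable_realfun.
Export Order.TTheory GRing.Theory Num.Theory.
Export numFieldNormedType.Exports.

Set Implicit Arguments.
Unset Strict Implicit.
Unset Printing Implicit Defensive.

Local Open Scope classical_set_scope.
Local Open Scope ring_scope.

Section calculus.
Context {R : realType}.

Definition state_space (a b : \bar R) : set R := [set x | (a < x%:E < b)%E].

(* The filter of c -> b-, for finite b and for b = +oo; only used when b <> -oo. *)
Definition left_of (b : \bar R) : set_system R :=
  if b is c%:E%E then at_left c else pinfty_nbhs R.

(* Meant for open D: derivatives are two-sided. *)
Definition C2_on (D : set R) (f : R -> R) : Prop :=
  forall x, D x -> [/\ derivable f x 1, derivable (derive1 f) x 1 &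
    {for x, continuous (derive1 (derive1 f))}].

(* Used at the exceptional points of a payoff, where it equals g'(x+) because
   g is continuous and g' has one-sided limits. *)
Definition right_derive (f : R -> R) (x : R) : R :=
  lim (h^-1 * (f (x + h) - f x) @[h --> 0^'+]).

Definition compact_C2 (a b : \bar R) (f : R -> R) : Prop :=
  C2_on setT f /\
  exists c d, [/\ state_space a b c, state_space a b d &
    forall z, ~ (c <= z <= d) -> f z = 0].

Definition generator (mu sigma : R -> R) (f : R -> R) (x : R) : R :=
  sigma x ^+ 2 / 2 * derive1 (derive1 f) x + mu x * derive1 f x.

End calculus.

(* A process with lifetime xi: X t w is meaningful only for 0 <= t < xi w, and
   afterwards the process sits in the cemetery. Functions vanish at the cemetery,
   so E_x[h(X_t)] is an integral over the event alive xi t. *)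
Section process.
Context {R : realType} {d : measure_display} {Omega : measurableType d}.
Variables (X : R -> Omega -> R) (xi : Omega -> \bar R).
Local Open Scope ereal_scope.

Definition alive (t : R) : set Omega := [set w | t%:E < xi w].

Definition cylinders (T : set R) : set_system Omega :=
  [set A | exists t B, [/\ T t, (0 <= t)%R, measurable B &
    A = alive t `&` X t @^-1` B]].

Definition natural_filtration (t : R) : set_system Omega :=
  <<s cylinders [set s | (s <= t)%R] >>.

(* Stopping times of the right-continuous filtration t |-> F_(t+). *)
Definition stopping_time (tau : Omega -> \bar R) : Prop :=
  (forall w, 0 <= tau w) /\
  forall t : R, (0 < t)%R -> natural_filtration t [set w | tau w < t%:E].

(* The sigma-algebra F_(tau+). *)
Definition stopped_event (tau : Omega -> \bar R) (A : set Omega) : Prop :=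
  forall t : R, (0 < t)%R -> natural_filtration t (A `&` [set w | tau w < t%:E]).

Definition up_time (z : R) (w : Omega) : \bar R :=
  ereal_inf [set t%:E | t in [set t : R | (0 <= t)%R /\ alive t w /\ (z <= X t w)%R]].

Definition running_sup (t : R) (w : Omega) : \bar R :=
  ereal_sup [set (X s w)%:E | s in [set s : R | (0 <= s <= t)%R /\ alive s w]].

End process.

(* P x is the law of the process started from x; it is only constrained for x in
   (a, b). theta t is the shift operator on paths. *)
Record regular_diffusion (R : realType) (d : measure_display)
    (Omega : measurableType d) (a b : \bar R) (mu sigma : R -> R)
    (X : R -> Omega -> R) (xi : Omega -> \bar R) (theta : R -> Omega -> Omega)
    (P : R -> probability Omega R) : Prop := RegularDiffusion {
  rd_itv : (a < b)%E ;
  rd_mu : forall x, state_space a b x -> {for x, continuous mu} ;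
  rd_sigma : forall x, state_space a b x -> {for x, continuous sigma} ;
  rd_sigma_gt0 : forall x, state_space a b x -> 0 < sigma x ;
  rd_lifetime : forall w, (0 <= xi w)%E ;
  rd_state : forall (t : R) (w : Omega), 0 <= t -> alive xi t w -> state_space a b (X t w) ;
  rd_continuous : forall w,
    {within [set t | 0 <= t /\ alive xi t w], continuous (X ^~ w)} ;
  (* the process does not die inside (a, b); in particular an accessible
     boundary kills *)
  rd_exit : forall w, (0 < xi w < +oo)%E ->
    ((X t w)%:E @[t --> at_left (fine (xi w))] --> a) \/
    ((X t w)%:E @[t --> at_left (fine (xi w))] --> b) ;
  rd_shift_lifetime : forall (t : R) (w : Omega), 0 <= t ->
    xi (theta t w) = maxe (xi w - t%:E)%E 0%E ;
  rd_shift : forall (s t : R) (w : Omega), 0 <= s -> 0 <= t -> alive xi (s + t) w ->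
    X s (theta t w) = X (s + t) w ;
  (* the sigma-algebra of Omega is the one generated by the process *)
  rd_measurable : @measurable d Omega = <<s cylinders X xi setT >> ;
  rd_start : forall x, state_space a b x ->
    P x (alive xi 0 `&` X 0 @^-1` [set x]) = 1%E ;
  rd_kernel : forall A : set Omega, measurable A ->
    measurable_fun (state_space a b) (fun x : R => (P x A : \bar R)) ;
  rd_strong_markov : forall (tau : Omega -> \bar R) (A : set Omega)
      (eta : Omega -> \bar R) (x : R),
    stopping_time X xi tau -> stopped_event X xi tau A ->
    measurable_fun setT eta -> (forall w, 0 <= eta w)%E -> state_space a b x ->
    let D := A `&` [set w | tau w < xi w]%E in
    (\int[P x]_(w in D) eta (theta (fine (tau w)) w) =
     \int[P x]_(w in D) \int[P (X (fine (tau w)) w)]_w' eta w')%E ;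
  rd_regular : forall x z, state_space a b x -> state_space a b z ->
    (0 < P x [set w | exists t : R, [/\ (0 <= t)%R, alive xi t w & X t w = z]])%E ;
  (* drift mu and volatility sigma: X solves the martingale problem of
     f |-> sigma^2 f'' / 2 + mu f' on compactly supported C^2 functions. For a
     Markov process the martingale property is equivalent to this identity for
     expectations. *)
  rd_generator : forall (f : R -> R) (x t : R),
    compact_C2 a b f -> state_space a b x -> 0 <= t ->
    (\int[P x]_(w in alive xi t) (f (X t w))%:E =
     (f x)%:E + \int[lebesgue_measure]_(s in `[0%R, t])
       \int[P x]_(w in alive xi s) (generator mu sigma f (X s w))%:E)%E
}.

Section problem.
Context {R : realType} {d : measure_display} {Omega : measurableType d}.
Variables (a b : \bar R) (mu sigma : R -> R).
Variables (X : R -> Omega -> R) (xi : Omega -> \bar R).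
Variables (P : R -> probability Omega R).
Variable (r : R).

(* The Laplace transform identity encodes the boundary conditions and determines
   psi up to a positive multiple. *)
Record increasing_fundamental_solution (psi : R -> R) : Prop := {
  ifs_C2 : C2_on (state_space a b) psi ;
  ifs_gt0 : forall x, state_space a b x -> 0 < psi x ;
  ifs_incr : forall x z, state_space a b x -> state_space a b z ->
    x < z -> psi x < psi z ;
  ifs_ode : forall x, state_space a b x ->
    generator mu sigma psi x - r * psi x = 0 ;
  ifs_laplace : forall x z, state_space a b x -> state_space a b z -> x <= z ->
    (\int[P x]_w expeR (- (r%:E * up_time X xi z w)) = (psi x / psi z)%:E)%E
}.

(* S is the finite exceptional set of the payoff g. *)
Record admissible_payoff (xg : R) (S : seq R) (g : R -> R) : Prop := {
  ap_continuous : forall x, state_space a b x -> {for x, continuous g} ;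
  ap_xg : state_space a b xg ;
  ap_pos : forall x, state_space a b x -> (0 < g x <-> xg < x) ;
  ap_sup : forall x, state_space a b x ->
    (\int[P x]_w ereal_sup [set (if (t%:E < xi w)%E
         then expR (- (r * t)) * g (X t w) else 0)%:E | t in [set t : R | (0 <= t)%R]]
     < +oo)%E ;
  ap_S : forall p, p \in S -> state_space a b p ;
  ap_C2 : C2_on (state_space a b `\` [set` S]) g ;
  ap_sides : forall p, p \in S ->
    [/\ cvg (derive1 g z @[z --> p^'-]), cvg (derive1 g z @[z --> p^'+]),
        cvg (derive1 (derive1 g) z @[z --> p^'-]) &
        cvg (derive1 (derive1 g) z @[z --> p^'+])]
}.

Definition payoff_derive (S : seq R) (g : R -> R) (x : R) : R :=
  if x \in S then right_derive g x else derive1 g x.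

Definition fhat (S : seq R) (g psi : R -> R) (x : R) : R :=
  g x - psi x * (payoff_derive S g x / derive1 psi x).

Definition V (g : R -> R) (y x : R) : \bar R :=
  (\int[P x]_(w in [set w | up_time X xi y w < +oo])
     (expR (- (r * fine (up_time X xi y w))) *
      g (X (fine (up_time X xi y w)) w))%:E)%E.

(* The integral in J is improper at b: it need not converge absolutely. *)
Definition J_partial (f psi : R -> R) (y x c : R) : R :=
  \int[lebesgue_measure]_(z in `[Num.max x y, c])
    (f z * (derive1 psi z / psi z ^+ 2)).

Definition J (f psi : R -> R) (y x : R) : R :=
  psi x * lim (J_partial f psi y x c @[c --> left_of b]).

Definition J_integrand (f : R -> R) (y : R) (p : Omega * R) : R :=
  f (fine (running_sup X xi p.2 p.1)) *
  \1_[set m | y%:E <= m < b]%E (running_sup X xi p.2 p.1).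

(* joint law of the path started at x and of an independent T ~ Exp(r) *)
Definition law_XT (x : R) : set (Omega * R) -> \bar R :=
  (P x \x exponential_prob r)%E.

Definition excessive (h : R -> \bar R) : Prop :=
  [/\ measurable_fun (state_space a b) h,
      forall x, state_space a b x -> (0 <= h x)%E,
      forall t x, 0 <= t -> state_space a b x ->
        (\int[P x]_(w in alive xi t) ((expR (- (r * t)))%:E * h (X t w)) <= h x)%E &
      forall x, state_space a b x ->
        (\int[P x]_(w in alive xi t) ((expR (- (r * t)))%:E * h (X t w)))%E
          @[t --> 0^'+] --> h x].

End problem.

(* Main.v *)
From HB Require Import structures.
Require Import Defs.
From mathcomp Require Import ring lra.

(** Since [f̂ ψ' / ψ^2 = - (g / ψ)'] off the exceptional set, [J_y] telescopes to
    [ψ(x) (g / ψ)(max x y)], and [V_y(x)] has the same value because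
    [X = max(X_0, y)] at [τ_y] and [E_x e^(-r τ_z) = ψ(x) / ψ(z)].

    For the probabilistic form of [J_y], [M_T >= z] holds exactly when [τ_z <= T], so
    that [P_x(M_T >= z) = ψ(x) / ψ(z)] for [z >= x], and [M_T] has density
    [ψ(x) ψ' / ψ^2] on [(x, b)].

    Excessivity: by the Markov property and the memorylessness of [T],
    [E_x e^(-r t) V_y(X_t)] is the expectation, on [T >= t], of [f̂ 1_[y, b)] at the
    supremum of the path over [[t, T]].  For a path alive at [t] this supremum reaches
    [b] exactly when the supremum over [[0, T]] does, so monotonicity of [f̂] on
    [[y, b)] bounds the expectation by [V_y(x)].  Convergence as [t] decreases to [0]
    is Fatou's lemma together with continuity of [V_y]. *)

Set Implicit Arguments.
Unset Strict Implicit.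
Unset Printing Implicit Defensive.

Local Open Scope classical_set_scope.
Local Open Scope ring_scope.

(** Dividing by [ψ'] requires [ψ' > 0], which strict monotonicity of [ψ] does not give; it comes
    from the differential equation.

    Death of the path is the obstacle on the probabilistic side. A path that leaves through [b] by
    time [T] has [M_T = b], a supremum that no time attains. The equivalence of [M_T >= z] and
    [τ_z <= T] therefore rests on the behaviour of the path at its lifetime and on [z] lying
    strictly inside the interval. Since [M_T] may carry mass at [b], its law is computed on [[m, c[]
    with [c] inside the interval, and [c] is sent to [b] afterwards.

    That limit is delicate because [f̂] may change sign and the integral in [J_y] may converge only
    conditionally. The two signed parts converge monotonically, while their difference is telescoped
    before the limit; one part must have finite expectation for the difference of the limits to make
    sense.

    For excessivity [f̂] is nonnegative on [[y, b)], so this difficulty disappears: Tonelli's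
    theorem and the Markov property at a fixed time are enough. *)

Section state_space.
Context {R : realType} (a b : \bar R).

Lemma state_space_itvE : state_space a b =
  [set x | (a < x%:E)%E] `&` [set x | (x%:E < b)%E].
Proof. by apply/seteqP; split => x /=; [case/andP|move=> [? ?]; apply/andP]. Qed.

Lemma open_state_space : open (state_space a b).
Proof.
rewrite state_space_itvE; apply: openI.
- case: a => [r||].
  + rewrite (_ : [set _ | _] = `]r, +oo[%classic); first exact: rray_open.
    by apply/seteqP; split => x /=; rewrite in_itv/= andbT lte_fin.
  + by rewrite (_ : [set _ | _] = set0)//; apply/seteqP; split => x.
  + rewrite (_ : [set _ | _] = setT); first exact: openT.
    by apply/seteqP; split => x //= _; rewrite ltNyr.
- case: b => [r||].
  + rewrite (_ : [set _ | _] = `]-oo, r[%classic); first exact: lray_open.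
    by apply/seteqP; split => x /=; rewrite in_itv/= lte_fin.
  + rewrite (_ : [set _ | _] = setT); first exact: openT.
    by apply/seteqP; split => x //= _; rewrite ltry.
  + by rewrite (_ : [set _ | _] = set0)//; apply/seteqP; split => x.
Qed.

Lemma measurable_state_space : measurable (state_space a b).
Proof. exact: open_measurable open_state_space. Qed.

Lemma state_space_le x z u : state_space a b x -> state_space a b z ->
  x <= u -> u <= z -> state_space a b u.
Proof.
move=> /andP[ax _] /andP[_ zb] xu uz; apply/andP; split.
- by rewrite (lt_le_trans ax)// lee_fin.
- by rewrite (le_lt_trans _ zb)// lee_fin.
Qed.

Lemma state_space_max x z : state_space a b x -> state_space a b z ->
  state_space a b (Num.max x z).
Proof. by move=> xI zI; case: (leP x z). Qed.

Lemma near_state_space x : state_space a b x -> \near x, state_space a b x.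
Proof. by move=> xI; apply: open_nbhs_nbhs; split => //; exact: open_state_space. Qed.

End state_space.

(** In the first case continuity of [f'] is enough. In the second the difference quotients of [f']
    at [x] are eventually positive, and over a negative increment this forces [f'] below
    [f'(x) = 0]. *)
Lemma ltr0_derive1_near_left {R : realType} (f : R -> R) (x : R) :
  derivable (derive1 f) x 1 ->
  (derive1 f x < 0 \/ derive1 f x = 0 /\ 0 < derive1 (derive1 f) x) ->
  \forall z \near x^'-, derive1 f z < 0.
Proof.
move=> df [fx0|[fx0 ffx0]].
- have cf : {for x, continuous (derive1 f)}.
    exact/differentiable_continuous/derivable1_diffP.
  apply: cvg_within; exact: (cvgr_lt _ cf).
have : (fun h => h^-1 *: (derive1 f (h *: 1 + x) - derive1 f x)) @ 0^' -->
    derive1 (derive1 f) x.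
  by rewrite (derive1E (derive1 f)); exact: df.
move=> /cvgr_gt /(_ _ ffx0).
rewrite near_withinE => -[e /= e0 he].
exists e => //= z /= xze zx.
have hz : z - x < 0 by rewrite subr_lt0.
have := he (z - x); rewrite /= sub0r normrN distrC => /(_ xze).
rewrite lt_eqF// => /(_ isT).
by rewrite fx0 subr0 /GRing.scale/= mulr1 subrK nmulr_rgt0 ?invr_lt0.
Qed.

(** * Regularity of [ψ] and positivity of [ψ'] *)

Section fundamental_solution.
Context {R : realType} {d : measure_display} {Omega : measurableType d}.
Variables (a b : \bar R) (mu sigma : R -> R) (X : R -> Omega -> R)
  (xi : Omega -> \bar R) (P : R -> probability Omega R) (r : R) (psi : R -> R).
Hypothesis hr : 0 < r.
Hypothesis sigma_gt0 : forall x, state_space a b x -> 0 < sigma x.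
Hypothesis hpsi : increasing_fundamental_solution a b mu sigma X xi P r psi.

Lemma ifs_derivable x : state_space a b x -> derivable psi x 1.
Proof. by move=> xI; have [] := ifs_C2 hpsi xI. Qed.

Lemma ifs_continuous x : state_space a b x -> {for x, continuous psi}.
Proof.
by move=> xI; apply/differentiable_continuous/derivable1_diffP/ifs_derivable.
Qed.

Lemma ifs_derive1_continuous x : state_space a b x ->
  {for x, continuous (derive1 psi)}.
Proof.
move=> xI; apply/differentiable_continuous/derivable1_diffP.
by have [] := ifs_C2 hpsi xI.
Qed.

(* At a zero of psi' the equation makes psi'' positive, so psi would decrease
   strictly just to the left of that point. *)
Lemma ifs_derive1_gt0 x : state_space a b x -> 0 < derive1 psi x.
Proof.
move=> xI; rewrite ltNge; apply/negP => psi'x.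
have : \forall z \near x^'-, derive1 psi z < 0.
  apply: ltr0_derive1_near_left; first by have [] := ifs_C2 hpsi xI.
  move: psi'x; rewrite le_eqVlt => /predU1P[psi'x|]; last by left.
  right; split => //; move: (ifs_ode hpsi xI); rewrite /generator psi'x mulr0.
  move=> /eqP; rewrite addr0 subr_eq0 => /eqP ode.
  have : 0 < sigma x ^+ 2 / 2 * derive1 (derive1 psi) x.
    by rewrite ode mulr_gt0// (ifs_gt0 hpsi).
  by rewrite pmulr_rgt0// divr_gt0// exprn_gt0// sigma_gt0.
move=> psi'neg.
have [e e0 he] : exists2 e : R, 0 < e &
    forall z, x - e < z < x -> derive1 psi z < 0 /\ state_space a b z.
  have : \forall z \near x^'-, derive1 psi z < 0 /\ state_space a b z.
    near=> z; split; first by near: z.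
    by near: z; apply: cvg_within; exact: near_state_space.
  move=> [e /= e0 he]; exists e => // z /andP[xez zx]; apply: he => //=.
  by rewrite gtr0_norm ?subr_gt0// ltrBlDr -ltrBlDl.
pose z1 := x - e / 2; pose z2 := x - e / 4.
have z1z2 : z1 < z2 by rewrite /z1 /z2; lra.
have hz z : z1 <= z <= z2 -> derive1 psi z < 0 /\ state_space a b z.
  by rewrite /z1 /z2 => /andP[? ?]; apply: he; apply/andP; split; lra.
have hz1 : state_space a b z1 by have [] := hz z1; rewrite // lexx/= ltW.
have hz2 : state_space a b z2 by have [] := hz z2; rewrite // lexx ltW.
have dz z : z \in `[z1, z2] -> derivable psi z 1.
  by rewrite in_itv/= => /hz[_ ?]; exact: ifs_derivable.
have := ifs_incr hpsi hz1 hz2 z1z2; apply/negP; rewrite -leNgt.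
apply/ltW/(@ltr0_derive1_decr _ psi z1 z2) => //.
- by move=> z zz; apply: dz; exact: subset_itv_oo_cc zz.
- by move=> z /subset_itv_oo_cc; rewrite /= in_itv/= => /hz[].
- apply: derivable_within_continuous => z; exact: dz.
Unshelve. all: by end_near. Qed.

End fundamental_solution.

(** * The function [f̂] and integration of [f̂ ψ' / ψ^2] over compact intervals *)

Section payoff.
Context {R : realType} {d : measure_display} {Omega : measurableType d}.
Variables (a b : \bar R) (mu sigma : R -> R) (X : R -> Omega -> R)
  (xi : Omega -> \bar R) (P : R -> probability Omega R) (r : R) (psi : R -> R)
  (xg : R) (S : seq R) (g : R -> R).
Hypothesis hr : 0 < r.
Hypothesis sigma_gt0 : forall x, state_space a b x -> 0 < sigma x.
Hypothesis hpsi : increasing_fundamental_solution a b mu sigma X xi P r psi.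
Hypothesis hg : admissible_payoff a b X xi P r xg S g.

Local Notation I := (state_space a b).
Local Notation f := (fhat S g psi).
Local Notation rho := (fun z => derive1 psi z / psi z ^+ 2).
Local Notation G := (fun z => g z / psi z).
Local Notation leb := (@lebesgue_measure R).

Let psi_neq0 z : I z -> psi z != 0.
Proof. by move=> zI; rewrite gt_eqF// (ifs_gt0 hpsi). Qed.

Let dpsi_neq0 z : I z -> derive1 psi z != 0.
Proof. by move=> zI; rewrite gt_eqF// (ifs_derive1_gt0 hr sigma_gt0 hpsi). Qed.

Lemma rho_ge0 z : I z -> 0 <= rho z.
Proof.
move=> zI; rewrite divr_ge0// ?exprn_ge0 ?ltW// ?(ifs_gt0 hpsi)//.
exact: ifs_derive1_gt0 hpsi _ _.
Qed.

Lemma rho_continuous z : I z -> {for z, continuous rho}.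
Proof.
move=> zI; apply: cvgM; first exact: (ifs_derive1_continuous hpsi zI).
apply: cvgV; first by rewrite expf_neq0// psi_neq0.
by under eq_fun do rewrite expr2; apply: cvgM; exact: (ifs_continuous hpsi zI).
Qed.

Lemma payoff_ratio_continuous z : I z -> {for z, continuous G}.
Proof.
move=> zI; apply: cvgM; first exact: (ap_continuous hg zI).
by apply: cvgV; [exact: psi_neq0|exact: (ifs_continuous hpsi zI)].
Qed.

Lemma closed_exceptional : closed [set` S].
Proof.
apply: (accessible_finite_set_closed.1 _); last exact: finite_seq.
exact/hausdorff_accessible/Rhausdorff.
Qed.

(** The filter is arbitrary so that one statement covers two-sided limits at regular points and
    one-sided limits at exceptional points, where [l] can differ from the value chosen for the
    derivative. *)
Lemma fhat_cvg (F : set_system R) (x l : R) : Filter F -> I x ->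
  F --> nbhs x -> (\forall z \near F, z \notin S) ->
  derive1 g z @[z --> F] --> l ->
  f z @[z --> F] --> g x - psi x * (l / derive1 psi x).
Proof.
move=> FF xI Fx FS gl.
have : (fun z => g z - psi z * (derive1 g z / derive1 psi z)) z @[z --> F]
    --> g x - psi x * (l / derive1 psi x).
  apply: cvgB; first exact: (cvg_trans (cvg_app _ Fx) (ap_continuous hg xI)).
  apply: cvgM; first exact: (cvg_trans (cvg_app _ Fx) (ifs_continuous hpsi xI)).
  apply: cvgM => //; apply: cvgV; first exact: dpsi_neq0.
  exact: (cvg_trans (cvg_app _ Fx) (ifs_derive1_continuous hpsi xI)).
apply: cvg_trans; apply: near_eq_cvg; near=> z.
rewrite /fhat /payoff_derive ifF//; apply/negbTE; by near: z.
Unshelve. all: by end_near. Qed.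

Lemma near_notin_exceptional x : x \notin S -> \forall z \near x, z \notin S.
Proof.
move=> xS; have : nbhs x (~` [set` S]).
  apply: open_nbhs_nbhs; split; first exact: closed_openC closed_exceptional.
  exact/negP.
by apply: filterS => z /= /negP.
Qed.

Lemma payoff_derivable x : I x -> x \notin S -> derivable g x 1.
Proof. by move=> xI xS; have [] := ap_C2 hg (conj xI (elimN idP xS)). Qed.

Lemma payoff_derive1_continuous x : I x -> x \notin S ->
  {for x, continuous (derive1 g)}.
Proof.
move=> xI xS; apply/differentiable_continuous/derivable1_diffP.
by have [] := ap_C2 hg (conj xI (elimN idP xS)).
Qed.

Lemma fhat_continuous x : I x -> x \notin S -> {for x, continuous f}.
Proof.
move=> xI xS; rewrite /prop_for /continuous_at.
rewrite [X in _ --> X]/fhat /payoff_derive (negbTE xS).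
apply: fhat_cvg => //; first exact: near_notin_exceptional.
exact: payoff_derive1_continuous.
Qed.

Lemma measurable_fhat : measurable_fun I f.
Proof.
have Sfin (A : set R) : A `<=` [set` S] -> measurable A.
  move=> AS; apply: countable_measurable; first by move=> t; exact: measurable_set1.
  by apply/finite_set_countable/(sub_finite_set AS).
have -> : I = (I `\` [set` S]) `|` (I `&` [set` S]).
  by rewrite setDE -setIUr setvU setIT.
have oIS : open (I `\` [set` S]).
  by apply: openI; [exact: open_state_space|exact: closed_openC closed_exceptional].
apply/measurable_funU.
- exact: open_measurable.
- exact: Sfin.
split.
- apply: open_continuous_measurable_fun => // x; rewrite inE => -[xI /negP xS].
  exact: fhat_continuous.
- by move=> _ Y mY; apply: Sfin => z [[]].
Qed.

Lemma measurable_rho : measurable_fun I rho.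
Proof.
apply: open_continuous_measurable_fun; first exact: open_state_space.
by move=> x; rewrite inE; exact: rho_continuous.
Qed.


Let k z := f z * rho z.

Let measurable_k A : measurable A -> A `<=` I -> measurable_fun A (EFin \o k).
Proof.
move=> mA AI; apply/measurable_EFinP/measurable_funM.
  by apply: measurable_funS measurable_fhat => //; exact: measurable_state_space.
by apply: measurable_funS measurable_rho => //; exact: measurable_state_space.
Qed.

Let k_cvg (F : set_system R) (x l : R) : Filter F -> I x ->
  F --> nbhs x -> (\forall z \near F, z \notin S) ->
  derive1 g z @[z --> F] --> l ->
  k z @[z --> F] --> (g x - psi x * (l / derive1 psi x)) * rho x.
Proof.
move=> FF xI Fx FS gl; apply: cvgM; first exact: fhat_cvg.
exact: (cvg_trans (cvg_app _ Fx) (rho_continuous xI)).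
Qed.

Let is_derive_ratio z : I z -> z \notin S ->
  is_derive z 1 (fun z => - G z) (k z).
Proof.
move=> zI zS.
have dpsi := DeriveDef (ifs_derivable hpsi zI) (esym (derive1E psi z)).
have dg := DeriveDef (payoff_derivable zI zS) (esym (derive1E g z)).
have dV := is_deriveV (psi_neq0 zI) dpsi.
apply: (is_derive_eq (is_deriveN (is_deriveM dg dV))).
rewrite /k /fhat /payoff_derive (negbTE zS) /GRing.scale/= -?exprVn; field.
by rewrite psi_neq0// dpsi_neq0.
Qed.

Let ftc_smooth u v : I u -> I v -> u < v ->
  (forall z, u < z < v -> z \notin S) ->
  leb.-integrable `[u, v] (EFin \o k) /\
  (\int[leb]_(z in `[u, v]) (k z)%:E = (G u - G v)%:E)%E.
Proof.
move=> uI vI uv uvS.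
have zI z : u <= z -> z <= v -> I z by exact: state_space_le.
have nearu : \forall z \near u^'+, z \notin S.
  near=> z; apply: uvS; apply/andP; split; near: z.
    exact: nbhs_right_gt.
  exact: nbhs_right_lt.
have nearv : \forall z \near v^'-, z \notin S.
  near=> z; apply: uvS; apply/andP; split; near: z.
    exact: nbhs_left_gt.
  exact: nbhs_left_lt.
have [lu klu] : exists l : R, k z @[z --> u^'+] --> l.
  have [l gl] : exists l : R, derive1 g z @[z --> u^'+] --> l.
    have [uS|uS] := boolP (u \in S).
      by have [_ /cvg_ex] := ap_sides hg uS.
    exists (derive1 g u); apply: cvg_at_right_filter.
    exact: payoff_derive1_continuous.
  exists ((g u - psi u * (l / derive1 psi u)) * rho u).
  by apply: (k_cvg _ _ _ _ gl) => //; exact: cvg_within.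
have [lv klv] : exists l : R, k z @[z --> v^'-] --> l.
  have [l gl] : exists l : R, derive1 g z @[z --> v^'-] --> l.
    have [vS|vS] := boolP (v \in S).
      by have [/cvg_ex] := ap_sides hg vS.
    exists (derive1 g v); apply: cvg_at_left_filter.
    exact: payoff_derive1_continuous.
  exists ((g v - psi v * (l / derive1 psi v)) * rho v).
  by apply: (k_cvg _ _ _ _ gl) => //; exact: cvg_within.
(* The endpoints may be exceptional, so [k] may jump there. With its one-sided limits as endpoint
   values it becomes continuous on the closed interval, and two points do not change the
   integral. *)
pose k' z := if z == u then lu else if z == v then lv else k z.
have k'E z : z \in `]u, v[ -> k' z = k z.
  by rewrite in_itv/= /k' => /andP[uz zv]; rewrite gt_eqF// lt_eqF.
have ck' : {within `[u, v], continuous k'}.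
  apply/(continuous_within_itvP _ uv); split.
  - move=> z zuv; have zS : z \notin S by apply: uvS; rewrite in_itv/= in zuv.
    have zI' : I z.
      by move: zuv; rewrite in_itv/= => /andP[/ltW ? /ltW ?]; exact: zI.
    rewrite /continuous_at k'E//.
    have : k w @[w --> z] --> k z.
      rewrite [X in _ --> X]/k /fhat /payoff_derive (negbTE zS).
      apply: k_cvg => //; first exact: near_notin_exceptional.
      exact: payoff_derive1_continuous.
    apply: cvg_trans; apply: near_eq_cvg; near=> w; rewrite k'E//.
    by near: w; exact: near_in_itvoo.
  - rewrite {2}/k' eqxx; apply: cvg_trans klu; apply: near_eq_cvg; near=> w.
    rewrite k'E// in_itv/=; apply/andP; split; near: w.
      exact: nbhs_right_gt.
    exact: nbhs_right_lt.
  - rewrite {2}/k' eqxx gt_eqF//; apply: cvg_trans klv; apply: near_eq_cvg.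
    near=> w; rewrite k'E// in_itv/=; apply/andP; split; near: w.
      exact: nbhs_left_gt.
    exact: nbhs_left_lt.
have ik' : leb.-integrable `[u, v] (EFin \o k').
  by apply: continuous_compact_integrable => //; exact: segment_compact.
have mk : measurable_fun `[u, v] (EFin \o k).
  by apply: measurable_k => // z /=; rewrite in_itv/= => /andP[]; exact: zI.
have ioo : (`]u, v[ : set R) `<=` `[u, v] by exact: subset_itv_oo_cc.
have moo (h : R -> R) : measurable_fun `[u, v] (EFin \o h) ->
    measurable_fun `]u, v[ h.
  by move=> mh; apply/measurable_EFinP; exact: measurable_funS mh.
split.
  apply/integrableP; split => //.
  have /integrableP[_] := ik'; apply: le_lt_trans.
  rewrite le_eqVlt; apply/predU1P; left.
  apply: (@eq_integral_itv_bounded _ u v (Num.norm \o k') (Num.norm \o k) true false).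
  - by apply: measurableT_comp => //; exact: moo.
  - by apply: measurableT_comp => //; exact: (moo _ (measurable_int leb ik')).
  - by move=> z zuv /=; rewrite k'E.
rewrite (@eq_integral_itv_bounded _ u v k' k true false); last 3 first.
- exact: moo.
- exact: (moo _ (measurable_int leb ik')).
- by move=> z zuv; rewrite k'E.
rewrite (@continuous_FTC2 _ k' (fun z => - G z))//.
- by congr EFin; ring.
- split.
  + move=> z zuv; have [] // := @is_derive_ratio z.
    * by move: zuv; rewrite in_itv/= => /andP[/ltW ? /ltW ?]; exact: zI.
    * by apply: uvS; rewrite in_itv/= in zuv.
  + by apply: cvgN; apply: cvg_at_right_filter; exact: payoff_ratio_continuous.
  + by apply: cvgN; apply: cvg_at_left_filter; exact: payoff_ratio_continuous.
- move=> z zuv; rewrite k'E// derive1E; apply: derive_val.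
  apply: is_derive_ratio.
  + by move: zuv; rewrite in_itv/= => /andP[/ltW ? /ltW ?]; exact: zI.
  + by apply: uvS; rewrite in_itv/= in zuv.
Unshelve. all: by end_near. Qed.

Let ftc_cat u p v : I u -> I v -> u <= p -> p <= v ->
  leb.-integrable `[u, p] (EFin \o k) /\
    (\int[leb]_(z in `[u, p]) (k z)%:E = (G u - G p)%:E)%E ->
  leb.-integrable `[p, v] (EFin \o k) /\
    (\int[leb]_(z in `[p, v]) (k z)%:E = (G p - G v)%:E)%E ->
  leb.-integrable `[u, v] (EFin \o k) /\
    (\int[leb]_(z in `[u, v]) (k z)%:E = (G u - G v)%:E)%E.
Proof.
move=> uI vI up pv [iup Iup] [ipv Ipv].
have uvI : [set` `[u, v]] `<=` I.
  by move=> z /=; rewrite in_itv/= => /andP[]; exact: state_space_le.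
have uvE : [set` `[u, v]] = [set` `[u, p[] `|` [set` `[p, v]].
  by rewrite -itv_bndbnd_setU ?bnd_simp.
have disj : [disjoint [set` `[u, p[] & [set` `[p, v]]].
  apply/disj_setPRL => z /=; rewrite !in_itv/= => /andP[pz _].
  by apply/negP; rewrite negb_and -leNgt pz orbT.
have mk : measurable_fun ([set` `[u, p[] `|` [set` `[p, v]]) (EFin \o k).
  by rewrite -uvE; exact: measurable_k.
have iup' : leb.-integrable `[u, p[ (EFin \o k).
  by apply: integrableS iup => //; exact: subset_itv_co_cc.
split; last first.
  rewrite uvE integral_setU => //; rewrite integral_itv_bndo_bndc.
    by rewrite Iup Ipv -EFinD; congr EFin; ring.
  exact: (measurable_int leb iup').
apply/integrableP; split; first by rewrite uvE.
rewrite uvE ge0_integral_setU => //; last exact: measurableT_comp mk.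
by apply: lte_add_pinfty; [have /integrableP[] := iup'|have /integrableP[] := ipv].
Qed.

Lemma fhat_integral u v : I u -> I v -> u <= v ->
  leb.-integrable `[u, v] (EFin \o k) /\
  (\int[leb]_(z in `[u, v]) (k z)%:E = (G u - G v)%:E)%E.
Proof.
(* The induction runs on a list containing the exceptional points strictly between [u] and [v],
   while the [S] inside [k] stays fixed. A head lying between them cuts the interval in two; any
   other head is dropped. *)
have : forall z, u < z < v -> z \in S -> z \in S by [].
elim: {2}S u v => [|p s IH] u v hS uI vI uv.
  move: uv; rewrite le_eqVlt => /predU1P[<-|uv].
    rewrite set_itv1 integral_set1 subrr; split => //.
    apply: null_set_integrable => //; last exact: lebesgue_measure_set1.
    by apply: measurable_k => // z ->.
  by apply: ftc_smooth => // z /hS h; apply/negP => /h.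
have [/andP[up pv]|upv] := boolP (u < p < v); last first.
  apply: IH => // z uzv zS; have := hS z uzv zS.
  by rewrite inE => /predU1P[zp|//]; move: upv; rewrite -zp uzv.
have pI : I p by apply: (state_space_le uI vI); exact: ltW.
apply: (@ftc_cat u p v) => //; try exact: ltW.
- apply: IH => //; last exact: ltW.
  move=> z /andP[uz zp] zS; have := hS z.
  by rewrite uz (lt_trans zp pv) inE (lt_eqF zp) => /(_ isT zS).
- apply: IH => //; last exact: ltW.
  move=> z /andP[pz zv] zS; have := hS z.
  by rewrite (lt_trans up pz) zv inE (gt_eqF pz) => /(_ isT zS).
Qed.

Lemma J_partialE y x c : I y -> I x -> I c -> Num.max x y <= c ->
  J_partial f psi y x c = G (Num.max x y) - G c.
Proof.
move=> yI xI cI mc; rewrite /J_partial /Rintegral.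
by rewrite (fhat_integral _ _ mc).2//; exact: state_space_max.
Qed.

End payoff.

(** * Approaching the right boundary *)

Section left_of.
Context {R : realType} (a b : \bar R).
Local Notation I := (state_space a b).

Lemma left_of_proper x : I x -> ProperFilter (left_of b).
Proof.
move=> /andP[]; rewrite /left_of.
case: b => [c||] ax // xb; [exact: at_left_proper_filter|exact: proper_pinfty_nbhs].
Qed.

Lemma near_left_of x : I x -> \forall c \near left_of b, x < c /\ I c.
Proof.
move=> /[dup] xI /andP[ax]; rewrite /I /state_space /left_of.
case: b => [c||] // xb; near=> z.
- have xz : x < z by near: z; apply: nbhs_left_gt; rewrite -lte_fin.
  split => //=; rewrite (lt_trans ax)//= lte_fin.
  by near: z; exact: nbhs_left_lt.
- have xz : x < z by near: z; exact: nbhs_pinfty_gt.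
  by split => //=; rewrite (lt_trans ax)//= ltry.
Unshelve. all: by end_near. Qed.

(** Monotone convergence over increasing events needs an increasing sequence in place of the
    filter. *)
Lemma left_of_sequence x : I x -> exists c : nat -> R,
  [/\ nondecreasing_seq c, forall n, x <= c n /\ I (c n) &
      c n @[n --> \oo] --> left_of b].
Proof.
move=> /[dup] xI /andP[ax]; rewrite /left_of /state_space.
case: b => [l||] // xb.
- have xl : x < l by rewrite -lte_fin.
  (* The sequence starts at [x] and stays strictly below [l], as the punctured filter [at_left l]
     demands. *)
  exists (fun n => l - (l - x) / n.+1%:R); split.
  + move=> m n mn; rewrite lerD2l lerN2 ler_wpM2l ?subr_ge0 ?(ltW xl)//.
    by rewrite lef_pV2 ?posrE// ler_nat.
  + move=> n; have lx0 : 0 < (l - x) / n.+1%:R by rewrite divr_gt0// subr_gt0.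
    have xc : x <= l - (l - x) / n.+1%:R.
      rewrite lerBrDl -lerBrDr ler_pdivrMr// ler_peMr ?subr_ge0 ?(ltW xl)//.
      by rewrite ler1n.
    split => //=; rewrite (lt_le_trans ax)//= lte_fin.
    by rewrite ltrBlDr ltrDl.
  + have cl : l - (l - x) / n.+1%:R @[n --> \oo] --> l.
      rewrite -[X in _ --> X]subr0; apply: cvgB; first exact: cvg_cst.
      rewrite -(mulr0 (l - x)); apply: cvgM; first exact: cvg_cst.
      exact: cvg_harmonic.
    move=> A hA; have {}hA : \forall n \near \oo,
      l - (l - x) / n.+1%:R < l -> A (l - (l - x) / n.+1%:R) := cl _ hA.
    apply: filterS hA => n; apply.
    by rewrite ltrBlDr ltrDl divr_gt0// subr_gt0.
- exists (fun n => x + n%:R); split.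
  + by move=> m n mn; rewrite lerD2l ler_nat.
  + move=> n; have xc : x <= x + n%:R by rewrite lerDl.
    by split => //=; rewrite (lt_le_trans ax)//= ltry.
  + move=> A [M [_ hA]]; suff : \forall n \near \oo, A (x + n%:R) by [].
    near=> n; apply: hA => /=; rewrite -ltrBlDl; near: n; exact: nbhs_infty_gtr.
Unshelve. all: by end_near. Qed.

End left_of.

(** * Running suprema and passage times of a single path *)

Section paths.
Context {R : realType} {d : measure_display} {Omega : measurableType d}.
Variables (a b : \bar R) (mu sigma : R -> R) (X : R -> Omega -> R)
  (xi : Omega -> \bar R) (theta : R -> Omega -> Omega)
  (P : R -> probability Omega R).
Hypothesis hX : regular_diffusion a b mu sigma X xi theta P.

Local Notation I := (state_space a b).
Local Notation alive := (alive xi).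
Local Notation tau := (up_time X xi).
Local Notation M := (running_sup X xi).
Implicit Types (w : Omega) (s t z : R).

Lemma alive_le s t w : s <= t -> alive t w -> alive s w.
Proof. by move=> st; apply: le_lt_trans; rewrite lee_fin. Qed.

Let path_continuous w :
  {within [set s | 0 <= s /\ alive s w], continuous (X ^~ w)} :=
  @rd_continuous _ _ _ _ _ _ _ _ _ _ _ hX w.

Lemma path_cvg w t : 0 <= t -> alive t w ->
  X s w @[s --> within [set s | 0 <= s /\ alive s w] (nbhs t)] --> X t w.
Proof.
move=> t0 tw.
by have /subspace_continuousP := @path_continuous w; exact.
Qed.

Lemma path_continuous_itv w s t : 0 <= s -> alive t w ->
  {within `[s, t], continuous (X ^~ w)}.
Proof.
move=> s0 tw; apply: continuous_subspaceW (@path_continuous w) => u /=.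
rewrite in_itv/= => /andP[su ut].
by split; [exact: le_trans su|exact: alive_le tw].
Qed.

Lemma path_max w t : 0 <= t -> alive t w ->
  exists2 c, 0 <= c <= t & forall s, 0 <= s <= t -> X s w <= X c w.
Proof.
move=> t0 tw; have := @path_continuous_itv w 0 t (lexx _) tw.
move=> /(EVT_max t0)[c]; rewrite in_itv/= => c0t hc.
by exists c.
Qed.

Lemma running_sup_ge w s t : 0 <= s -> s <= t -> alive s w ->
  ((X s w)%:E <= M t w)%E.
Proof.
by move=> s0 st sw; apply: ereal_sup_ubound; exists s => //; rewrite /= s0.
Qed.

Lemma running_sup_le w t (y : \bar R) :
  (forall s, 0 <= s <= t -> alive s w -> ((X s w)%:E <= y)%E) -> (M t w <= y)%E.
Proof.
by move=> h; apply: ge_ereal_sup => _ [s [s0t sw] <-]; exact: h.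
Qed.

Lemma running_sup_attained w t : 0 <= t -> alive t w ->
  exists2 c, 0 <= c <= t & M t w = (X c w)%:E.
Proof.
move=> t0 tw; have [c /andP[c0 ct] hc] := path_max t0 tw.
exists c; first by rewrite c0.
apply/eqP; rewrite eq_le running_sup_ge ?andbT//; last exact: alive_le tw.
by apply: running_sup_le => s s0t _; rewrite lee_fin hc.
Qed.

Lemma running_sup_lt_b w t : 0 <= t -> alive t w -> (M t w < b)%E.
Proof.
move=> t0 tw; have [c /andP[c0 ct] ->] := running_sup_attained t0 tw.
by have /andP[] := rd_state hX c0 (alive_le ct tw).
Qed.

Lemma up_time_ge0 z w : (0 <= tau z w)%E.
Proof. by apply: le_ereal_inf_tmp => _ [t [t0 _] <-]; rewrite lee_fin. Qed.

Lemma up_time_le z w t : 0 <= t -> alive t w -> z <= X t w ->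
  (tau z w <= t%:E)%E.
Proof. by move=> t0 tw zX; apply: ereal_inf_lbound; exists t. Qed.

(** Times with [X >= z] accumulate at the infimum from the right, and the path is alive there
    because it is alive at such a later or equal time. If the value at the infimum were below [z],
    continuity would keep the path below [z] just afterwards. *)
Lemma up_time_attained z w : (tau z w < +oo)%E ->
  exists t, [/\ tau z w = t%:E, 0 <= t, alive t w & z <= X t w].
Proof.
move=> tauoo; have taufin : tau z w \is a fin_num.
  by rewrite ge0_fin_numE// up_time_ge0.
have t0 : 0 <= fine (tau z w) by rewrite fine_ge0// up_time_ge0.
have adh e : 0 < e -> exists s,
    [/\ fine (tau z w) <= s, s < fine (tau z w) + e, 0 <= s, alive s w & z <= X s w].
  move=> e0; have [_ [s [s0 [sw zs]] <-]] := lb_ereal_inf_adherent e0 taufin.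
  rewrite -[X in (_ < X + _)%E](fineK taufin) -EFinD lte_fin => se.
  by exists s; split => //; rewrite -lee_fin fineK// up_time_le.
have tw : alive (fine (tau z w)) w.
  by have [s [ts _ _ sw _]] := adh 1 ltr01; exact: alive_le sw.
exists (fine (tau z w)); split => //; first by rewrite fineK.
rewrite leNgt; apply/negP => Xz.
have := cvgr_lt _ (path_cvg t0 tw) _ Xz; rewrite near_withinE.
move=> [e /= e0 he]; have [s [ts ste s0 sw]] := adh e e0.
apply/negP; rewrite -ltNge; apply: he => //=.
by rewrite distrC ger0_norm ?subr_ge0// ltrBlDl.
Qed.

(** The hard direction shows that a path staying below [z] up to [t] has its supremum strictly below
    [z]. If it is alive at [t], the supremum is attained. If it has died by then, exit towards [b]
    would have carried it above [z], and exit towards [a] keeps its last stretch away from [z]. *)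
Lemma running_sup_up_time z w t : I z -> (z%:E <= M t w)%E = (tau z w <= t%:E)%E.
Proof.
move=> /andP[az zb]; apply/idP/idP; last first.
  move=> tau_t; have tau_oo : (tau z w < +oo)%E.
    by rewrite (le_lt_trans tau_t)// ltry.
  have [s [taus s0 sw zs]] := up_time_attained tau_oo.
  apply: (@le_trans _ _ (X s w)%:E); first by rewrite lee_fin.
  by apply: running_sup_ge => //; rewrite -lee_fin -taus.
move=> zM; rewrite leNgt; apply/negP => ttau.
have Xz s : 0 <= s <= t -> alive s w -> X s w < z.
  move=> /andP[s0 st] sw; rewrite ltNge; apply/negP => zX.
  have := le_lt_trans (up_time_le s0 sw zX) (le_lt_trans _ ttau).
  by rewrite lee_fin st ltxx => /(_ isT).
(* With no living time in [[0, t]] the supremum is over the empty set and equals [-oo]. *)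
have [s0 /andP[s0ge0 s0t] s0w] : exists2 s, 0 <= s <= t & alive s w.
  apply: contrapT => h; move: zM; apply/negP; rewrite -ltNge.
  apply: (@le_lt_trans _ _ -oo%E); last exact: ltNyr.
  by apply: running_sup_le => s st sw; exfalso; apply: h; exists s.
have t0 : 0 <= t by exact: le_trans s0t.
have [tw|ntw] := pselect (alive t w).
  have [c /andP[c0 ct] Mc] := running_sup_attained t0 tw.
  move: zM; rewrite Mc lee_fin leNgt Xz// ?c0//; exact: alive_le tw.
have xit : (xi w <= t%:E)%E by rewrite leNgt; exact/negP.
have xi0 : (0 < xi w)%E by apply: le_lt_trans s0w; rewrite lee_fin.
have xioo : (xi w < +oo)%E by rewrite (le_lt_trans xit) ?ltry.
have xifin : xi w \is a fin_num by rewrite ge0_fin_numE// ltW.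
have nearxi : \forall s \near (fine (xi w))^'-, 0 <= s <= t /\ alive s w.
  near=> s; have sxi : s < fine (xi w) by near: s; exact: nbhs_left_lt.
  split; last by rewrite /alive/= -(fineK xifin) lte_fin.
  apply/andP; split.
    by near: s; apply: nbhs_left_ge; rewrite fine_gt0// xi0.
  by apply: (le_trans (ltW sxi)); rewrite -lee_fin fineK.
have xi0oo : (0 < xi w < +oo)%E by rewrite xi0.
have [Xa|Xb] := rd_exit hX xi0oo; last first.
  have near_z : \forall s \near (fine (xi w))^'-, (z%:E < (X s w)%:E)%E.
    apply: (Xb [set y | (z%:E < y)%E]); apply: open_nbhs_nbhs.
    by split => //; exact: open_ereal_gt_ereal.
 have [s [[s0t' sw] zs]] :
      exists s, (0 <= s <= t /\ alive s w) /\ (z%:E < (X s w)%:E)%E.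
    by apply: (@filter_ex _ ((fine (xi w))^'-)); near=> s; split; near: s.
  by have := Xz _ s0t' sw; rewrite ltNge ltW// -lte_fin.
(* Near the lifetime the bound must be some [z' < z]: values merely below [z] could still have
   supremum [z]. *)
have [z' /andP[az' z'z]] : exists z' : R, (a < z'%:E)%E && (z' < z).
  move: az; case: (a) => [r||]//.
  + rewrite lte_fin => /midf_lt[? ?]; exists ((r + z) / 2).
    by rewrite lte_fin; apply/andP.
  + by move=> _; exists (z - 1); rewrite ltNyr/= ltrBlDr ltrDl.
have near_z' : \forall s \near (fine (xi w))^'-, (X s w < z').
  have : \forall s \near (fine (xi w))^'-, ((X s w)%:E < z'%:E)%E.
    apply: (Xa [set y | (y < z'%:E)%E]); apply: open_nbhs_nbhs.
    by split => //; exact: open_ereal_lt_ereal.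
  by apply: filterS => s; rewrite lte_fin.
have [e e0 he] : exists2 e, 0 < e & forall s, fine (xi w) - e < s ->
    s < fine (xi w) -> X s w < z'.
  have [e /= e0 he] := near_z'; exists e => // s es sxi; apply: he => //=.
  by rewrite gtr0_norm ?subr_gt0// ltrBlDr -ltrBlDl.
(* Up to [u] the path lives on a compact interval and attains its maximum; after [u] it lies below
   [z']. *)
pose u := Num.max 0 (fine (xi w) - e / 2).
have u0 : 0 <= u by rewrite le_max lexx.
have uxi : u < fine (xi w).
  by rewrite gt_max fine_gt0 ?xi0//= ltrBlDr ltrDl divr_gt0.
have uw : alive u w by rewrite /alive/= -(fineK xifin) lte_fin.
have [c /andP[c0 cu] hc] := path_max u0 uw.
have cw : alive c w := alive_le cu uw.
have ct : c <= t.
  apply: (le_trans cu); apply: (le_trans (ltW uxi)).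
  by rewrite -lee_fin fineK.
move: zM; apply/negP; rewrite -ltNge.
apply: (@le_lt_trans _ _ (Num.max z' (X c w))%:E); last first.
  by rewrite lte_fin gt_max z'z Xz// c0.
apply: running_sup_le => s /andP[s0' st'] sw; rewrite lee_fin le_max.
have [su|us] := leP s u; first by rewrite (hc s) ?orbT// s0'.
rewrite ltW// he//; last by rewrite -lte_fin fineK.
move: us; rewrite /u gt_max => /andP[_]; apply: le_lt_trans.
by rewrite lerD2l lerN2 ler_pdivrMr// ler_pMr// ler1n.
Unshelve. all: by end_near. Qed.

End paths.

(** * Position at a passage time, and measurability of suprema and passage times *)

Section measurability.
Context {R : realType} {d : measure_display} {Omega : measurableType d}.
Variables (a b : \bar R) (mu sigma : R -> R) (X : R -> Omega -> R)
  (xi : Omega -> \bar R) (theta : R -> Omega -> Omega)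
  (P : R -> probability Omega R).
Hypothesis hX : regular_diffusion a b mu sigma X xi theta P.

Local Notation I := (state_space a b).
Local Notation alive := (alive xi).
Local Notation tau := (up_time X xi).
Local Notation M := (running_sup X xi).
Implicit Types (w : Omega) (s t z : R).

(** A path starting at or above [z] has passage time 0. One starting below cannot overshoot: the
    intermediate value theorem gives a time of value exactly [z], which minimality identifies with
    the passage time. *)
Lemma up_time_position w z : (tau z w < +oo)%E ->
  X (fine (tau z w)) w = Num.max (X 0 w) z.
Proof.
move=> /(up_time_attained hX)[t [taut t0 tw zX]]; rewrite taut/=.
have tw0 : alive 0 w by exact: alive_le tw.
have tau_le s : 0 <= s -> s <= t -> z <= X s w -> s = t.
  move=> s0 st zXs; apply/eqP; rewrite eq_le st/= -lee_fin -taut.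
  exact: up_time_le (alive_le st tw) zXs.
have [zX0|X0z] := leP z (X 0 w); first by rewrite -(tau_le 0).
apply/eqP; rewrite eq_le zX andbT leNgt; apply/negP => zXt.
have [|c] := IVT t0 (path_continuous_itv hX (lexx 0) tw) (v := z).
  by rewrite ge_min (ltW X0z) le_max zX orbT.
rewrite in_itv/= => /andP[c0 ct] Xc.
by move: zXt; rewrite -(tau_le c) ?Xc ?ltxx.
Qed.

Lemma measurable_cylinder t (B : set R) : 0 <= t -> measurable B ->
  measurable (alive t `&` X t @^-1` B).
Proof.
move=> t0 mB; rewrite (rd_measurable hX); apply: sub_sigma_algebra.
by exists t, B.
Qed.

Lemma measurable_alive t : 0 <= t -> measurable (alive t).
Proof.
move=> t0; have := measurable_cylinder t0 measurableT.
by rewrite preimage_setT setIT.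
Qed.

Lemma measurable_position t : 0 <= t -> measurable_fun (alive t) (X t).
Proof. by move=> t0 _ B mB; exact: measurable_cylinder. Qed.

(** By continuity a strict exceedance at [s > 0] persists at rational times just before [s], where
    the path is still alive; [s = 0] is itself rational. The event becomes a countable union. *)
Lemma running_sup_gt z w t : (z%:E < M t w)%E <->
  exists q : rat, [/\ 0 <= (ratr q : R), (ratr q : R) <= t, alive (ratr q) w &
    z < X (ratr q) w].
Proof.
split=> [/ereal_sup_gt[_ [s [/andP[s0 st] sw] <-]]|[q [q0 qt qw zX]]]; last first.
  apply: (@lt_le_trans _ _ (X (ratr q) w)%:E); first by rewrite lte_fin.
  exact: running_sup_ge.
rewrite lte_fin => zX; move: s0; rewrite le_eqVlt => /predU1P[s0|s0].
  by exists 0; rewrite rmorph0 s0.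
have := cvgr_gt _ (path_cvg hX (ltW s0) sw) _ zX; rewrite near_withinE.
move=> [e /= e0 he].
have [q] : exists q : rat, ratr q \in `]Num.max 0 (s - e), s[.
  by apply: rat_in_itvoo; rewrite gt_max s0/= ltrBlDr ltrDl.
rewrite in_itv/= gt_max => /andP[/andP[q0 seq] qs].
have qw : alive (ratr q) w := alive_le (ltW qs) sw.
exists q; split => //; try exact: ltW; first by rewrite ltW// (lt_le_trans qs).
apply: he => //=; last by split => //; exact: ltW.
by rewrite gtr0_norm ?subr_gt0// ltrBlDr -ltrBlDl.
Qed.

(** Joint measurability in path and time is needed because [T] is random. For each rational time the
    exceedance event is a rectangle: a cylinder of paths times a half-line of [t]. *)
Lemma measurable_running_sup :
  measurable_fun setT (fun p : Omega * measurableTypeR R => M p.2 p.1).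
Proof.
apply: (measurability (@ErealGenOInfty.G R)); first exact: ErealGenOInfty.measurableE.
move=> _ [_ [z ->] <-]; rewrite setTI.
rewrite (_ : _ @^-1` _ = \bigcup_(q : rat)
    (if 0 <= (ratr q : R)
     then (alive (ratr q) `&` X (ratr q) @^-1` `]z, +oo[) `*` `[ratr q, +oo[
     else set0)); last first.
  apply/seteqP; split => [[w t] /=|[w t] [q _]].
    rewrite in_itv/= andbT => /running_sup_gt[q [q0 qt qw zX]].
    by exists q => //; rewrite q0; do !split => //=; rewrite in_itv/= ?andbT.
  case: ifPn => // q0 [[/= qw]]; rewrite !in_itv/= !andbT => zX qt.
  by apply/running_sup_gt; exists q.
apply: bigcupT_measurable_rat => q; case: ifPn => // q0.
by apply: measurableX => //; exact: measurable_cylinder.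
Qed.

Lemma measurable_running_sup1 t : measurable_fun setT (M t).
Proof.
apply: (@measurableT_comp _ _ _ _ _ _
  (fun p : Omega * measurableTypeR R => M p.2 p.1) _ (fun w => (w, t))).
  exact: measurable_running_sup.
exact: measurable_fun_pair.
Qed.

Lemma measurable_up_time z : I z -> measurable_fun setT (tau z).
Proof.
move=> zI.
apply: (measurability (@ErealGenOInfty.G R)); first exact: ErealGenOInfty.measurableE.
move=> _ [_ [t ->] <-]; rewrite setTI.
rewrite (_ : _ @^-1` _ = ~` [set w | (z%:E <= M t w)%E]).
  apply: measurableC; rewrite -[X in measurable X]setTI.
  by apply: emeasurable_fun_c_infty => //; exact: measurable_running_sup1.
apply/seteqP; split => w /=; rewrite (running_sup_up_time hX)// in_itv/= andbT ltNge.
  by move/negP.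
by move=> ?; exact/negP.
Qed.

End measurability.

(** Right half-lines are stable under intersection and generate the Borel sets, and the half-lines
    from [-n] exhaust the line. Laws can thus be compared through their tails. *)
Lemma eq_measure_itvcy {R : realType}
    (m1 m2 : {measure set (measurableTypeR R) -> \bar R}) :
  (m1 setT < +oo)%E ->
  (forall u : R, m1 [set` `[u, +oo[] = m2 [set` `[u, +oo[]) ->
  forall A, measurable A -> m1 A = m2 A.
Proof.
move=> m1oo m12 A mA.
apply: (@measure_unique _ R (measurableTypeR R) (@RGenCInfty.G R)
  (fun n => [set` `[- n%:R, +oo[])) mA.
- exact: RGenCInfty.measurableE.
- move=> _ _ [u ->] [v ->]; exists (Num.max u v).
  apply/seteqP; split => x /=; rewrite !in_itv/= !andbT ge_max.
    by case=> -> ->.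
  by case/andP.
- by move=> n; exists (- n%:R).
- apply/seteqP; split => // x _.
  have [n _ /(_ n (leqnn _)) xn] := nbhs_infty_gtr (- x).
  by exists n => //=; rewrite in_itv/= andbT lerNl ltW.
- by move=> _ [u ->]; exact: m12.
- by move=> n; apply: le_lt_trans m1oo; apply: le_measure; rewrite ?inE.
Qed.

(** * The exponential time and its memorylessness *)

Section exponential_law.
Context {R : realType} (r : R) (hr : 0 < r).

Definition exponential_law : probability (measurableTypeR R) R :=
  exponential_distribution_exponential_prob__canonical__probability_measure_Probability hr.

Lemma exponential_lawE : exponential_law = exponential_prob r :> (set R -> \bar R).
Proof. by []. Qed.

Lemma exponential_law_itvcy s : 0 <= s ->
  exponential_law [set` `[s, +oo[] = (expR (- (r * s)))%:E.
Proof.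
move=> s0; rewrite exponential_lawE /exponential_prob.
have ce : continuous (fun z : R => - expR (- r * z)).
  move=> z; apply: cvgN; apply: continuous_comp; last exact: continuous_expR.
  by apply: cvgM; [exact: cvg_cst|exact: cvg_id].
rewrite (@ge0_continuous_FTC2y _ _ (fun x => - expR (- r * x)) _ 0).
- by rewrite sub0e -EFinN opprK mulNr.
- by move=> x _; apply: exponential_pdf_ge0; exact: ltW.
- apply: continuous_subspaceW (@within_continuous_exponential_pdf R r).
  by move=> x /=; rewrite !in_itv/= !andbT; exact: le_trans.
- rewrite -oppr0; apply: cvgN.
  rewrite (_ : (fun x => expR (- r * x)) =
               (fun z => expR (- z)) \o (fun z => r * z)); last first.
    by apply: eq_fun => x; rewrite mulNr.
  apply: (@cvg_comp _ _ _ _ _ _ (pinfty_nbhs R)); last exact: cvgr_expR.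
  exact: gt0_cvgMry.
- by move=> x _; exact: ex_derive.
- exact/cvg_at_right_filter/ce.
- move=> z; rewrite in_itv/= andbT => sz; apply: derive1_exponential_pdf.
  by rewrite in_itv/= andbT (le_lt_trans s0).
Qed.

(** Applied to a passage time, this reads the discount factor as the probability that [T] comes no
    earlier; [x = +oo] covers paths that never arrive. *)
Lemma exponential_law_gey (x : \bar R) : (0 <= x)%E ->
  exponential_law [set t | (x <= t%:E)%E] = expeR (- (r%:E * x)).
Proof.
case: x => [s||]// s0.
- by rewrite -EFinM -EFinN [RHS]/= -exponential_law_itvcy//; congr (exponential_law _);
    apply/seteqP; split => t /=; rewrite in_itv/= andbT.
- rewrite gt0_muley ?lte_fin//= -[RHS](measure0 exponential_law).
  by congr (exponential_law _); apply/seteqP; split => t.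
Qed.

(** The left side equals the expectation of [phi(T)] on the event [T >= t]; nonnegativity of [phi]
    then removes the restriction. *)
Lemma exponential_law_memoryless (t : R) (phi : R -> \bar R) : 0 <= t ->
  measurable_fun setT phi -> (forall u, 0 <= phi u)%E ->
  ((expR (- (r * t)))%:E * \int[exponential_law]_u phi (t + u)%R <=
   \int[exponential_law]_u phi u)%E.
Proof.
move=> t0 mphi phi0.
pose f (u : measurableTypeR R) : measurableTypeR R := t + u.
have mshift : measurable_fun setT f by exact: measurable_funD.
pose D : set (measurableTypeR R) := [set` `[t, +oo[].
have mD : measurable D by exact: measurable_itv.
pose pf : {measure set (measurableTypeR R) -> \bar R} :=
  pushforward exponential_law f.
pose m1 := pf mshift.
pose k := NngNum (expR_ge0 (- (r * t))).
have eqm A : measurable A ->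
    mscale k m1 A = exponential_law (A `&` D).
  apply: (@eq_measure_itvcy _ (mscale k m1) (mrestr exponential_law mD)).
    change ((expR (- (r * t)))%:E * exponential_law (f @^-1` setT) < +oo)%E.
    by rewrite preimage_setT probability_setT mule1 ltry.
  move=> u.
  change ((expR (- (r * t)))%:E * exponential_law (f @^-1` [set` `[u, +oo[]) =
    exponential_law ([set` `[u, +oo[] `&` [set` `[t, +oo[]))%E.
  have -> : [set` `[u, +oo[] `&` [set` `[t, +oo[] = [set` `[Num.max u t, +oo[].
    apply/seteqP; split => x /=; rewrite !in_itv/= !andbT ge_max; first by case=> -> ->.
    by case/andP.
  have -> : f @^-1` [set` `[u, +oo[] = [set` `[u - t, +oo[].
    by apply/seteqP; split => x /=; rewrite !in_itv/= !andbT lerBlDl.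
  rewrite (@exponential_law_itvcy (Num.max u t)) ?le_max ?t0 ?orbT//.
  (* For [u <= t] the shifted half-line has full mass and both sides are [e^(-r t)]; for [u > t] the
     exponents add up to [-r u]. *)
  have [ut|tu] := leP u t.
    suff -> : exponential_law [set` `[u - t, +oo[] = 1%E by rewrite mule1.
    apply/eqP; rewrite eq_le probability_le1//=.
    rewrite -expR0 -oppr0 -(mulr0 r) -exponential_law_itvcy//.
    apply: le_measure; rewrite ?inE// => x /=; rewrite !in_itv/= !andbT.
    by apply: le_trans; rewrite subr_le0.
  rewrite exponential_law_itvcy ?subr_ge0 1?ltW// -EFinM -expRD.
  by congr (expR _)%:E; ring.
have -> : (\int[exponential_law]_u phi (t + u)%R =
           \int[m1]_u phi u)%E.
  by rewrite [RHS]ge0_integral_pushforward//= preimage_setT.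
have <- : (\int[mscale k m1]_u phi u =
  (expR (- (r * t)))%:E * \int[m1]_u phi u)%E.
  exact: (ge0_integral_mscale m1 measurableT k mphi (fun x _ => phi0 x)).
rewrite -(setUv D) ge0_integral_setU//=; last 3 first.
- exact: measurableC.
- by rewrite setUv.
- exact/disj_setPCl.
rewrite [X in (_ + X)%E]null_set_integral ?adde0; last 3 first.
- exact: measurableC.
- by apply: measurable_funS mphi => //; exact: measurableT.
- by rewrite [LHS]eqm ?setICl ?measure0//; exact: measurableC.
rewrite (eq_measure_integral exponential_law) => [|A mA AD]; last first.
  by rewrite [LHS]eqm// setIidl.
by rewrite setUv; apply: ge0_subset_integral.
Qed.

End exponential_law.

(** The density is known only inside [D], so it is the restriction of [nu] to [D] that is absolutely
    continuous. Its Radon-Nikodym derivative agrees with [k] almost everywhere on [D], and change of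
    variables for that derivative gives the formula. *)
Lemma ge0_integral_density {R : realType} {d : measure_display}
    {T : measurableType d} (nu : {finite_measure set T -> \bar R})
    (mu : {sigma_finite_measure set T -> \bar R}) (D : set T)
    (k phi : T -> \bar R) :
  measurable D -> measurable_fun D k ->
  (forall A, measurable A -> A `<=` D -> nu A = \int[mu]_(x in A) k x)%E ->
  measurable_fun D phi -> (forall x, 0 <= phi x)%E ->
  (\int[nu]_(x in D) phi x = \int[mu]_(x in D) (phi x * k x))%E.
Proof.
move=> mD mk nuE mphi phi0.
have nuoo : (nu D < +oo)%E by rewrite ltey_eq fin_num_measure.
pose nuD : {finite_measure set T -> \bar R} := mfrestr mD nuoo.
have nuDE A : measurable A -> (nuD A = \int[mu]_(x in A `&` D) k x)%E.
  by move=> mA; rewrite -nuE//; exact: measurableI.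
have -> : (\int[nu]_(x in D) phi x = \int[nuD]_(x in D) phi x)%E.
  apply: eq_measure_integral => A mA AD.
  by apply: (etrans (nuE A mA AD)); rewrite -[in LHS](setIidl AD); exact/esym/nuDE.
have numu : nuD `<< mu.
  apply/null_content_dominatesP => A mA A0; rewrite nuDE//.
  apply: null_set_integral.
  - exact: measurableI.
  - exact: measurable_funS mk.
  - by apply: subset_measure0 A0; rewrite ?inE//; exact: measurableI.
rewrite -(Radon_Nikodym_SigmaFinite.change_of_variables numu)//.
have mRN := measurable_int _ (Radon_Nikodym_SigmaFinite.f_integrable numu).
apply: ae_eq_integral => //.
- by apply: emeasurable_funM => //; exact: measurable_funTS.
- exact: emeasurable_funM.
apply: ae_eqe_mul2l; apply: integral_ae_eq => //.
- by apply: integrableS (Radon_Nikodym_SigmaFinite.f_integrable numu).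
move=> A AD mA; rewrite -Radon_Nikodym_SigmaFinite.f_integral// nuDE//.
by rewrite setIidl.
Qed.

(** * Law of the supremum at the exponential time *)

Section law_of_supremum.
Context {R : realType} {d : measure_display} {Omega : measurableType d}.
Variables (a b : \bar R) (mu sigma : R -> R) (X : R -> Omega -> R)
  (xi : Omega -> \bar R) (theta : R -> Omega -> Omega)
  (P : R -> probability Omega R).
Hypothesis hX : regular_diffusion a b mu sigma X xi theta P.
Variables (r : R) (psi : R -> R).
Hypothesis hr : 0 < r.
Hypothesis hpsi : increasing_fundamental_solution a b mu sigma X xi P r psi.

Local Notation I := (state_space a b).
Local Notation rho := (fun z => derive1 psi z / psi z ^+ 2).
Local Notation leb := (@lebesgue_measure R).
Local Notation PT := (Omega * measurableTypeR R)%type.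
Local Notation M p := (running_sup X xi p.2 p.1).

Let mM : measurable_fun setT (fun p : Omega * measurableTypeR R => M p).
Proof. exact: (measurable_running_sup hX). Qed.

Definition law_path_time (x : R) : probability (Omega * measurableTypeR R)%type R :=
  (P x \x exponential_law hr)%E.

Let measurable_M_ge (y : \bar R) : measurable [set p : PT | (y <= M p)%E].
Proof. by rewrite -[X in measurable X]setTI; exact: emeasurable_fun_c_infty. Qed.

Let measurable_M_lt (y : \bar R) : measurable [set p : PT | (M p < y)%E].
Proof. by rewrite -[X in measurable X]setTI; exact: emeasurable_fun_infty_o. Qed.

Lemma measurable_running_sup_itv (y z : \bar R) :
  measurable [set p : PT | (y <= running_sup X xi p.2 p.1 < z)%E].
Proof.
rewrite (_ : [set _ | _] =
  [set p : PT | (y <= M p)%E] `&` [set p : PT | (M p < z)%E]).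
  exact: measurableI.
by apply/seteqP; split => p /=; [move/andP|move=> [-> ->]].
Qed.

(** Integrating over the time first, a fixed path contributes the probability of [τ_z <= T], that is
    [e^(-r τ_z)]; what remains is the Laplace transform of [τ_z]. *)
Lemma law_sup_ge x z : I x -> I z -> x <= z ->
  law_path_time x [set p : PT | (z%:E <= running_sup X xi p.2 p.1)%E] =
  (psi x / psi z)%:E.
Proof.
move=> xI zI xz; rewrite -(ifs_laplace hpsi xI zI xz).
rewrite /law_path_time/= /product_measure1; apply: eq_integral => w _ /=.
rewrite -exponential_law_gey ?up_time_ge0//; apply: (congr1 (exponential_prob r)).
by apply/seteqP; split => t; rewrite /xsection/= ?inE /= (running_sup_up_time hX).
Qed.

Lemma law_sup_itv x u c : I x -> I u -> I c -> x <= u -> u <= c ->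
  law_path_time x [set p : PT | (u%:E <= running_sup X xi p.2 p.1 < c%:E)%E] =
  (psi x / psi u - psi x / psi c)%:E.
Proof.
move=> xI uI cI xu uc.
rewrite (_ : [set _ | _] =
  [set p : PT | (u%:E <= M p)%E] `\` [set p : PT | (c%:E <= M p)%E]).
  rewrite measureD//; last by rewrite [ltLHS](law_sup_ge xI uI xu) ltry.
  rewrite setIidr; last by move=> p /=; apply: le_trans; rewrite lee_fin.
  rewrite EFinB; congr (_ - _)%E; first exact: law_sup_ge.
  by apply: law_sup_ge => //; exact: le_trans uc.
apply/seteqP; split => p /=; first by case/andP => -> Mc; split => //; rewrite leNgt Mc.
by case=> uM /negP; rewrite -ltNge => Mc; apply/andP.
Qed.

Lemma law_sup_lt_start x : I x ->
  law_path_time x [set p : PT | (running_sup X xi p.2 p.1 < x%:E)%E] = 0%E.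
Proof.
move=> xI; have -> : [set p : PT | (running_sup X xi p.2 p.1 < x%:E)%E] =
    ~` [set p : PT | (x%:E <= M p)%E].
  by apply/seteqP; split => p /=; rewrite ltNge => /negP.
rewrite probability_setC// [X in (_ - X)%E](law_sup_ge xI xI)// divff ?subee//.
by rewrite gt_eqF// (ifs_gt0 hpsi).
Qed.


(** A primitive of the integrand is [-ψ(x) / ψ]. The half-open interval matches the event in
    [law_sup_itv]. *)
Lemma rho_integral x u c : I u -> I c -> u <= c ->
  (\int[leb]_(z in `[u, c[) (psi x * rho z)%:E =
   (psi x / psi u - psi x / psi c)%:E)%E.
Proof.
move=> uI cI; rewrite le_eqVlt => /predU1P[<-|uc].
  by rewrite set_itvco0 integral_set0 subrr.
have zI z : u <= z <= c -> I z by move=> /andP[]; exact: state_space_le.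
have dz z : I z -> is_derive z 1 (fun z => - (psi x / psi z)) (psi x * rho z).
  move=> zI'; have psi0 : psi z != 0 by rewrite gt_eqF// (ifs_gt0 hpsi).
  have dpsi := DeriveDef (ifs_derivable hpsi zI') (esym (derive1E psi z)).
  have dV := is_deriveV psi0 dpsi.
  apply: (is_derive_eq (is_deriveN (is_deriveM (is_derive_cst _ _ _) dV))).
  by rewrite /GRing.scale/= mulr0 addr0 -exprVn; ring.
have cz z : I z -> {for z, continuous (fun z => - (psi x / psi z))}.
  move=> zI'; apply/differentiable_continuous/derivable1_diffP.
  by have [] := dz z zI'.
rewrite integral_itv_bndo_bndc; last first.
  apply/measurable_EFinP/measurable_funM => //.
  apply: measurable_funS (measurable_rho hpsi); first exact: measurable_state_space.
  by move=> z /=; rewrite in_itv/= => /andP[uz /ltW zc]; apply: zI; rewrite uz.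
rewrite (@continuous_FTC2 _ _ (fun z => - (psi x / psi z)))//.
- by rewrite -EFinD opprK addrC.
- apply: continuous_in_subspaceT => z; rewrite inE/= in_itv/= => /zI zI'.
  by apply: cvgM; [exact: cvg_cst|exact: (rho_continuous hpsi zI')].
- split.
  + move=> z; rewrite in_itv/= => /andP[/ltW uz /ltW zc].
    by have [] := dz z (zI z _); rewrite ?uz.
  + by apply: cvg_at_right_filter; apply: cz.
  + by apply: cvg_at_left_filter; apply: cz.
- move=> z; rewrite in_itv/= => /andP[/ltW uz /ltW zc]; rewrite derive1E.
  by apply: derive_val; apply: dz; apply: zI; rewrite uz.
Qed.

Hypothesis sigma_gt0 : forall x, state_space a b x -> 0 < sigma x.

(** The image law and the candidate density agree on half-lines cut to [[m, c[], by [law_sup_itv]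
    and [rho_integral], hence on all Borel subsets of that interval. *)
Lemma law_sup_density x m c (phi : R -> \bar R) : I x -> I m -> I c ->
  x <= m -> m <= c -> measurable_fun I phi -> (forall z, 0 <= phi z)%E ->
  (\int[law_path_time x]_(p in [set p | (m%:E <= running_sup X xi p.2 p.1 < c%:E)%E])
     phi (fine (running_sup X xi p.2 p.1)) =
   \int[leb]_(z in `[m, c[) (phi z * (psi x * rho z)%:E))%E.
Proof.
move=> xI mI cI xm mc mphi phi0.
have zI z : m <= z < c -> I z by move=> /andP[mz /ltW]; exact: state_space_le mz.
pose D : set (measurableTypeR R) := [set` `[m, c[].
have mD : measurable D by exact: measurable_itv.
have DE z : D z = (m <= z < c) by rewrite /D/mkset in_itv.
have DI : D `<=` I by move=> z; rewrite DE; exact: zI.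
pose A : set (Omega * measurableTypeR R) := [set p | (m%:E <= M p < c%:E)%E].
have mA : measurable A by exact: measurable_running_sup_itv.
(* A real-valued stand-in for the supremum. Outside [A] it takes the value [c], which is not in [D],
   so that the preimage of [D] is exactly [A]. *)
pose N (p : Omega * measurableTypeR R) : measurableTypeR R :=
  if (m%:E <= M p < c%:E)%E then fine (M p) else c.
have NE p : A p -> N p = fine (M p) by rewrite /N /A/= => ->.
have mN : measurable_fun setT N.
  apply: measurable_fun_ifT => //.
  - apply: (measurable_fun_bool true); rewrite setTI.
    rewrite (_ : _ @^-1` _ = A)//.
  - apply: measurableT_comp => //.
have ND : N @^-1` D = A.
  apply/seteqP; split => p; rewrite /preimage/= DE /A /N/=.
    by case: ifPn => //; rewrite ltxx andbF.
  move=> Ap; rewrite Ap; case: (running_sup X xi p.2 p.1) Ap => [s||] //.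
  by move=> /andP[_]; rewrite ltNge leey.
pose fN : {mfun (Omega * measurableTypeR R)%type >-> measurableTypeR R} :=
  HB.pack N (isMeasurableFun.Build _ _ _ _ _ mN).
pose nu : probability (measurableTypeR R) R := distribution (law_path_time x) fN.
pose k (z : measurableTypeR R) : \bar R := (psi x * rho z)%:E.
have mk : measurable_fun D k.
  apply/measurable_EFinP/measurable_funM => //.
  by apply: measurable_funS (measurable_rho hpsi) => //; exact: measurable_state_space.
have k0 z : D z -> (0 <= k z)%E.
  move=> /DI zI'; rewrite lee_fin mulr_ge0 ?(rho_ge0 hr sigma_gt0 hpsi)//.
  exact/ltW/(ifs_gt0 hpsi).
have mkD : measurable_fun setT (k \_ D) by apply/(measurable_restrictT _ _).1.
have kD0 z : (0 <= (k \_ D) z)%E by apply: erestrict_ge0.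
(* Cutting the density off outside [D] gives a measure on the whole line, comparable with the
   restriction of [nu] to [D]. *)
pose m2 (B : set (measurableTypeR R)) := (\int[leb]_(z in B) (k \_ D) z)%E.
have m20 : m2 set0 = 0%E by rewrite /m2 integral_set0.
have m2ge0 B : (0 <= m2 B)%E by apply: integral_ge0.
pose m2' : {measure set (measurableTypeR R) -> \bar R} :=
  HB.pack m2 (isMeasure.Build _ _ _ m2 m20 m2ge0
    (semi_sigma_additive_nng_induced mkD kD0)).
have nuE B : measurable B -> B `<=` D -> nu B = (\int[leb]_(z in B) k z)%E.
  move=> mB BD; transitivity (mrestr nu mD B); first by rewrite /mrestr setIidl.
  transitivity (m2' B); last first.
    by rewrite /m2'/= /m2 -integral_mkcondr setIidl.
  apply: eq_measure_itvcy => //.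
    by rewrite /mrestr (le_lt_trans (probability_le1 _ _)) ?ltry//; exact: measurableI.
  move=> u; change (nu ([set` `[u, +oo[] `&` D) = m2 [set` `[u, +oo[]).
  rewrite /m2 -integral_mkcondr.
  have [cu|uc] := leP c (Num.max u m).
    rewrite (_ : _ `&` D = set0); first by rewrite integral_set0; exact: (measure0 nu).
    apply/seteqP; split => // z [/=]; rewrite in_itv/= andbT DE => uz /andP[mz zc].
    by move: cu; rewrite leNgt gt_max (le_lt_trans uz zc) (le_lt_trans mz zc).
  have uDE : [set` `[u, +oo[] `&` D = [set` `[Num.max u m, c[].
    apply/seteqP; split => z; rewrite /= DE !in_itv/= andbT ge_max.
      by move=> [-> /andP[-> ->]].
    by move=> /andP[/andP[-> ->] ->].
  have uI : I (Num.max u m).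
    by apply: (state_space_le mI cI); rewrite ?le_max ?lexx ?orbT// ltW.
  rewrite uDE [RHS](rho_integral x uI cI (ltW uc)).
  rewrite -(law_sup_itv xI uI cI _ (ltW uc)); last by rewrite le_max xm orbT.
  rewrite /nu/= /distribution /pushforward; congr (law_path_time x _).
  apply/seteqP; split => q; rewrite /preimage/= in_itv/= /N.
    case: ifPn => [|_]; last by rewrite ltxx andbF.
    case: (running_sup X xi q.2 q.1) => [s _||] //=.
    by rewrite ?lee_fin ?lte_fin ?ltNge ?leey ?andbF.
  move=> /andP[uM Mc]; have mM' : (m%:E <= running_sup X xi q.2 q.1)%E.
    by apply: le_trans uM; rewrite lee_fin le_max lexx orbT.
  rewrite mM' Mc/=; move: mM' uM Mc; case: (running_sup X xi q.2 q.1) => [s|_ _|] //.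
  by rewrite !lee_fin lte_fin => _ -> ->.
have mphiD : measurable_fun D phi.
  by apply: measurable_funS mphi => //; exact: measurable_state_space.
transitivity (\int[nu]_(z in D) phi z)%E; last exact: ge0_integral_density.
transitivity (\int[law_path_time x]_(p in N @^-1` D) (phi \o N) p)%E; last first.
  by apply/esym/ge0_integral_pushforward.
by rewrite ND; apply: eq_integral => p; rewrite inE => /NE /= ->.
Qed.

End law_of_supremum.

(** * Closed form of [V_y] *)

Section value.
Context {R : realType} {d : measure_display} {Omega : measurableType d}.
Variables (a b : \bar R) (mu sigma : R -> R) (X : R -> Omega -> R)
  (xi : Omega -> \bar R) (theta : R -> Omega -> Omega)
  (P : R -> probability Omega R).
Hypothesis hX : regular_diffusion a b mu sigma X xi theta P.
Variables (r : R) (psi : R -> R).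
Hypothesis hr : 0 < r.
Hypothesis hpsi : increasing_fundamental_solution a b mu sigma X xi P r psi.
Variables (xg : R) (S : seq R) (g : R -> R).
Hypothesis hg : admissible_payoff a b X xi P r xg S g.

Local Notation I := (state_space a b).
Local Notation alive := (alive xi).
Local Notation tau := (up_time X xi).

Let started (x : R) : set Omega := alive 0 `&` X 0 @^-1` [set x].

Lemma measurable_payoff : measurable_fun I g.
Proof.
apply: open_continuous_measurable_fun; first exact: open_state_space.
by move=> x; rewrite inE => xI; exact: (ap_continuous hg xI).
Qed.

Lemma measurable_started x : measurable (started x).
Proof. exact: (measurable_cylinder hX). Qed.

Lemma probability_not_started x : I x -> P x (~` started x) = 0%E.
Proof.
move=> xI; rewrite probability_setC ?(rd_start hX xI)// ?subee//.
exact: measurable_started.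
Qed.

(** For [y <= x] both passage times are 0. Raising the level to [max x y] makes the Laplace
    transform identity applicable, which needs a level at or above the start. *)
Lemma up_time_started x y w : started x w ->
  tau y w = tau (Num.max x y) w.
Proof.
move=> [w0 Xx]; have [yx|//] := leP y x.
have tau0 z : z <= x -> tau z w = 0%E.
  move=> zx; apply/eqP; rewrite eq_le up_time_ge0 andbT.
  by apply: up_time_le => //; rewrite Xx.
by rewrite !tau0.
Qed.

Let D z : set Omega := [set w | (tau z w < +oo)%E].
Let q z (w : Omega) : \bar R := expeR (- (r%:E * tau z w)).
Let e z (w : Omega) : R := expR (- (r * fine (tau z w))).

Let measurable_D z : I z -> measurable (D z).
Proof.
move=> zI; rewrite -[D z]setTI; apply: emeasurable_fun_infty_o => //.
exact: (measurable_up_time hX).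
Qed.

(** As [r > 0], the discount factor vanishes when the passage time is infinite. *)
Let qE z : q z = (EFin \o e z) \_ (D z).
Proof.
apply/funext => w; rewrite patchE /q; case: ifPn => [|].
  rewrite inE => Dw; have /fineK tauw : tau z w \is a fin_num.
    by rewrite ge0_fin_numE ?up_time_ge0.
  by rewrite -[in LHS]tauw.
rewrite notin_setE => /negP; rewrite -leNgt leye_eq => /eqP ->.
by rewrite gt0_muley ?lte_fin.
Qed.

Let measurable_e z : I z -> measurable_fun setT (e z).
Proof.
move=> zI; apply: measurableT_comp => //; apply: measurable_funN.
apply: measurable_funM => //; apply: measurableT_comp; first exact: fine_measurable.
exact: (measurable_up_time hX).
Qed.

Let measurable_q z : I z -> measurable_fun setT (q z).
Proof.
move=> zI; rewrite qE; apply/(measurable_restrictT _ _).1.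
  exact: measurable_D.
by apply: measurable_funTS; apply/measurable_EFinP; exact: measurable_e.
Qed.

Lemma payoff_gt0 x y : I x -> I y -> 0 < g y -> 0 < g (Num.max x y).
Proof.
move=> xI yI gy; apply/(ap_pos hg); first exact: state_space_max.
by rewrite lt_max; apply/orP; right; apply/(ap_pos hg yI).
Qed.

Lemma VE x y : I x -> I y -> 0 < g y ->
  V X xi P r g y x = (psi x * (g (Num.max x y) / psi (Num.max x y)))%:E.
Proof.
move=> xI yI gy; set m := Num.max x y.
have mI : I m by exact: state_space_max.
have D0 w : D y w -> alive 0 w.
  by move=> /(up_time_attained hX)[t [_ t0 tw _]]; exact: alive_le tw.
(* Expressing the stopped position through [X 0] makes measurability immediate, with no position at
   a random time left. *)
pose h w : \bar R := (e y w * g (Num.max (X 0 w) y))%:E.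
have -> : V X xi P r g y x = (\int[P x]_(w in D y) h w)%E.
  by apply: eq_integral => w; rewrite inE => Dw; rewrite /h (up_time_position hX).
have mh : measurable_fun (D y) h.
  apply/measurable_EFinP/measurable_funM.
    by apply: measurable_funTS; exact: measurable_e.
  apply: (measurable_comp (F := I)) measurable_payoff _.
  - exact: measurable_state_space.
  - move=> _ [w /D0 w0 <-]; apply: state_space_max => //.
    exact: (rd_state hX).
  - apply: measurable_funS (measurable_maxr (measurable_position hX (lexx 0)) _) => //.
    exact: measurable_alive hX _ _.
transitivity (\int[P x]_w ((g m)%:E * q m w))%E.
  rewrite [LHS]integral_mkcond; apply: ae_eq_integral => //.
  - by apply/(measurable_restrictT _ _).1 => //; exact: measurable_D.
  - by apply: measurable_funeM; exact: measurable_q.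
  (* On paths started at [x] the payoff is the constant [g m]; the other paths form a null set. *)
  exists (~` started x); split.
  + exact/measurableC/measurable_started.
  + exact: probability_not_started.
  + move=> w /= hw wx; apply: hw => _.
    have -> : q m w = q y w by rewrite /q (up_time_started y wx).
    rewrite qE !patchE; case: ifPn; last by rewrite mule0.
    by rewrite /h; move: wx => [_ /= ->] _; rewrite mulrC EFinM.
rewrite ge0_integralZl//; last 3 first.
- exact: measurable_q.
- by move=> w _; exact: expeR_ge0.
- by rewrite lee_fin ltW// payoff_gt0.
rewrite (ifs_laplace hpsi xI mI); last by rewrite le_max lexx.
by rewrite -EFinM; congr EFin; rewrite mulrCA mulrA.
Qed.

End value.

(** * The two forms of [J_y] *)

Section representation.
Context {R : realType} {d : measure_display} {Omega : measurableType d}.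
Variables (a b : \bar R) (mu sigma : R -> R) (X : R -> Omega -> R)
  (xi : Omega -> \bar R) (theta : R -> Omega -> Omega)
  (P : R -> probability Omega R).
Hypothesis hX : regular_diffusion a b mu sigma X xi theta P.
Variables (r : R) (psi : R -> R).
Hypothesis hr : 0 < r.
Hypothesis hpsi : increasing_fundamental_solution a b mu sigma X xi P r psi.
Variables (xg : R) (S : seq R) (g : R -> R).
Hypothesis hg : admissible_payoff a b X xi P r xg S g.
Hypothesis hlim : g x / psi x @[x --> left_of b] --> (0 : R).

Local Notation I := (state_space a b).
Local Notation rho := (fun z => derive1 psi z / psi z ^+ 2).
Local Notation leb := (@lebesgue_measure R).
Local Notation PT := (Omega * measurableTypeR R)%type.
Local Notation f := (fhat S g psi).
Local Notation G := (fun z => g z / psi z).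
Local Notation M p := (running_sup X xi p.2 p.1).
Local Notation law := (law_path_time P hr).

Let sigma_gt0 := rd_sigma_gt0 hX.

Let mf : measurable_fun I f.
Proof. exact: (measurable_fhat hr sigma_gt0 hpsi hg). Qed.

Lemma J_partial_cvg x y : I x -> I y ->
  J_partial f psi y x c @[c --> left_of b] --> G (Num.max x y).
Proof.
move=> xI yI; have mI : I (Num.max x y) by exact: state_space_max.
have FF := left_of_proper mI.
have : G (Num.max x y) - G c @[c --> left_of b] --> G (Num.max x y) - 0.
  by apply: cvgB => //; exact: cvg_cst.
rewrite subr0; apply: cvg_trans; apply: near_eq_cvg.
apply: filterS (near_left_of mI) => c [mc cI].
by rewrite (J_partialE hr sigma_gt0 hpsi hg)// ltW.
Qed.

Lemma JE x y : I x -> I y -> J b f psi y x = psi x * G (Num.max x y).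
Proof.
move=> xI yI; rewrite /J; congr (_ * _).
have FF := left_of_proper xI.
by apply: cvg_lim => //; exact: J_partial_cvg.
Qed.

Lemma measurable_comp_running_sup y (phi : R -> \bar R) : I y -> measurable_fun I phi ->
  measurable_fun [set p : PT | (y%:E <= M p < b)%E]
    (fun p => phi (fine (M p))).
Proof.
move=> yI mphi.
have mM := measurable_running_sup hX.
apply: (measurable_comp (F := I) _ _ mphi).
- exact: measurable_state_space.
- move=> _ [p /= /andP[yM Mb] <-]; move: yM Mb.
  have /andP[ay _] := yI.
  case: (running_sup X xi p.2 p.1) => [s||]//=; last by move=> _; rewrite ltNge leey.
  by move=> ys sb; rewrite /state_space/= sb (lt_le_trans ay).
- by apply: measurable_funTS; apply: measurableT_comp => //; exact: fine_measurable.
Qed.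

(** Monotone convergence in the events [m <= M < c n], which increase to [m <= M < b]. The strict
    bound [M < b] is what places each path in one of them. *)
Lemma law_sup_density_cvg x y (c : nat -> R) (phi : R -> \bar R) :
  I x -> I y -> nondecreasing_seq c ->
  (forall n, Num.max x y <= c n /\ I (c n)) -> c n @[n --> \oo] --> left_of b ->
  measurable_fun I phi -> (forall z, 0 <= phi z)%E ->
  (\int[leb]_(z in `[(Num.max x y), (c n)[) (phi z * (psi x * rho z)%:E))%E
    @[n --> \oo] -->
  (\int[law x]_(p in [set p | (y%:E <= M p < b)%E]) phi (fine (M p)))%E.
Proof.
move=> xI yI ndc cI cb mphi phi0; set m := Num.max x y.
have mI : I m by exact: state_space_max.
have FF := left_of_proper mI.
under eq_fun => n.
  rewrite -(law_sup_density hX hr hpsi sigma_gt0 xI mI (cI n).2 _ (cI n).1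
    mphi phi0); last first.
    by rewrite le_max lexx.
  over.
pose Bn n : set (Omega * measurableTypeR R) := [set p | (m%:E <= M p < (c n)%:E)%E].
have -> : (\int[law x]_(p in [set p | (y%:E <= M p < b)%E]) phi (fine (M p)) =
    \int[law x]_(p in \bigcup_n Bn n) phi (fine (M p)))%E.
  have mM := measurable_running_sup hX.
  pose N : set (Omega * measurableTypeR R) := [set p | (M p < x%:E)%E].
  rewrite (@ge0_negligible_integral _ _ _ _ _ N)//; last 4 first.
  - by rewrite -[X in measurable X]setTI; exact: emeasurable_fun_infty_o.
  - exact: (measurable_running_sup_itv hX).
  - exact: measurable_comp_running_sup.
  - exact: (law_sup_lt_start hX hr hpsi).
  congr (integral _ _ _); apply/seteqP; split => p.
  - move=> [/= /andP[yM Mb] /negP]; rewrite /N/= -leNgt => xM.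
    have mMp : (m%:E <= M p)%E by rewrite /m; case: (leP x y).
    have [s Ms] : exists s, M p = s%:E.
      move: mMp Mb; case: (running_sup X xi p.2 p.1) => [s||]//; first by exists s.
      by move=> _; rewrite ltNge leey.
    have sI : I s.
      have /andP[am _] := mI; rewrite /state_space/= -Ms Mb andbT.
      exact: lt_le_trans mMp.
    have [n [sc _]] : exists n, s < c n /\ I (c n).
      by apply: (@filter_ex _ \oo); exact: cb _ (near_left_of sI).
    by exists n => //; rewrite /Bn/= mMp Ms lte_fin.
  - move=> [n _ /andP[mM' Mc]]; have [_ /andP[_ cb']] := cI n; split => /=.
      rewrite (lt_trans Mc cb') andbT (le_trans _ mM')//.
      by rewrite lee_fin le_max lexx orbT.
    by apply/negP; rewrite -leNgt (le_trans _ mM')// lee_fin le_max lexx.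
apply: ge0_nondecreasing_set_cvg_integral.
- move=> i j ij; apply/subsetPset => p /andP[mM' Mc]; apply/andP; split => //.
  by rewrite (lt_le_trans Mc)// lee_fin ndc.
- by move=> n; exact: (measurable_running_sup_itv hX).
- move=> n; apply: measurable_funS (measurable_comp_running_sup yI mphi).
    exact: (measurable_running_sup_itv hX).
  move=> p /andP[mM' Mc]; have [_ /andP[_ cb']] := cI n.
  rewrite /= (lt_trans Mc cb') andbT (le_trans _ mM')//.
  by rewrite lee_fin le_max lexx orbT.
- by [].
Qed.

Let F y (p : Omega * measurableTypeR R) : \bar R := (J_integrand b X xi f y p)%:E.

Let B y : set (Omega * measurableTypeR R) := [set p | (y%:E <= M p < b)%E].

Let FE y : F y = (fun p => (f (fine (M p)))%:E) \_ (B y).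
Proof.
apply/funext => p; rewrite /F /J_integrand patchE indicE.
case: ifPn; rewrite ?inE ?notin_setE /B/= => h.
  by rewrite mem_set// mulr1.
by rewrite memNset// mulr0.
Qed.

Lemma measurable_J_integrand y : I y -> measurable_fun setT (F y).
Proof.
move=> yI; rewrite FE; apply/(measurable_restrictT _ _).1; first exact: (measurable_running_sup_itv hX).
apply: (measurable_comp_running_sup (phi := EFin \o f)) => //.
by apply/measurable_EFinP; exact: mf.
Qed.

(** For each [n] both signed parts have finite integrals over [[m, c n[], and their difference
    telescopes to [ψ(x) (G m - G (c n))]. Each part converges by monotone convergence, and the
    finiteness assumption rules out [+oo - +oo] for the limits, so uniqueness of limits identifies
    the value. *)
Lemma integral_J_integrand x y : I x -> I y ->
  (\int[law x]_p ((F y)^\+ p) < +oo \/ \int[law x]_p ((F y)^\- p) < +oo)%E ->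
  (\int[law x]_p F y p = (psi x * G (Num.max x y))%:E)%E.
Proof.
move=> xI yI fin; set m := Num.max x y.
have mI : I m by exact: state_space_max.
have [c [ndc cI cb]] := left_of_sequence mI.
pose h z : \bar R := (f z)%:E.
pose kk z := f z * rho z.
have mh : measurable_fun I h by apply/measurable_EFinP.
have mcI n : [set` `[m, (c n)[] `<=` I.
  move=> z /=; rewrite in_itv/= => /andP[mz /ltW zc].
  exact: state_space_le mI (cI n).2 mz zc.
have psi0 : 0 <= psi x by apply/ltW/(ifs_gt0 hpsi).
have ftc n := fhat_integral hr sigma_gt0 hpsi hg mI (cI n).2 (cI n).1.
have ikk n : leb.-integrable [set` `[m, (c n)[] (EFin \o kk).
  by apply: integrableS (ftc n).1 => //; exact: subset_itv_co_cc.
have mkk n := measurable_int _ (ikk n).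
have posE n : (\int[leb]_(z in `[m, (c n)[) (h^\+ z * (psi x * rho z)%:E) =
    (psi x)%:E * \int[leb]_(z in `[m, (c n)[) (EFin \o kk)^\+ z)%E.
  rewrite -ge0_integralZl//; last exact: measurable_funepos.
  apply: eq_integral => z; rewrite inE => /mcI zI.
  have rho0 := rho_ge0 hr sigma_gt0 hpsi zI.
  rewrite !funeposE /= -!EFin_max -!EFinM mulrCA; congr (_ * _)%:E.
  by rewrite maxr_pMl// mul0r.
have negE n : (\int[leb]_(z in `[m, (c n)[) (h^\- z * (psi x * rho z)%:E) =
    (psi x)%:E * \int[leb]_(z in `[m, (c n)[) (EFin \o kk)^\- z)%E.
  rewrite -ge0_integralZl//; last exact: measurable_funeneg.
  apply: eq_integral => z; rewrite inE => /mcI zI.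
  have rho0 := rho_ge0 hr sigma_gt0 hpsi zI.
  rewrite !funenegE /= -!EFin_max -!EFinM mulrCA; congr (_ * _)%:E.
  by rewrite maxr_pMl// mul0r mulNr.
have cvg_pos := law_sup_density_cvg xI yI ndc cI cb
  (measurable_funepos mh) (funepos_ge0 h).
have cvg_neg := law_sup_density_cvg xI yI ndc cI cb
  (measurable_funeneg mh) (funeneg_ge0 h).
have FposE : (\int[law x]_p (F y)^\+ p = \int[law x]_(p in B y) h^\+ (fine (M p)))%E.
  rewrite FE funepos_restrict -integral_mkcond.
  by apply: eq_integral => p _; rewrite !funeposE.
have FnegE : (\int[law x]_p (F y)^\- p = \int[law x]_(p in B y) h^\- (fine (M p)))%E.
  rewrite FE funeneg_restrict -integral_mkcond.
  by apply: eq_integral => p _; rewrite !funenegE.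
rewrite integralE.
have fin_pos n : (\int[leb]_(z in `[m, (c n)[) (EFin \o kk)^\+ z)%E \is a fin_num.
  exact: integrable_pos_fin_num.
have fin_neg n : (\int[leb]_(z in `[m, (c n)[) (EFin \o kk)^\- z)%E \is a fin_num.
  exact: integrable_neg_fin_num.
have diffE n : (\int[leb]_(z in `[m, (c n)[) (h^\+ z * (psi x * rho z)%:E) -
   \int[leb]_(z in `[m, (c n)[) (h^\- z * (psi x * rho z)%:E) =
   (psi x * (G m - G (c n)))%:E)%E.
  rewrite posE negE -muleBr//; last by apply: fin_num_adde_defr; exact: fin_pos.
  rewrite -integralE integral_itv_bndo_bndc//.
    by rewrite (ftc n).2 EFinM.
  exact: mkk.
have FF := left_of_proper mI.
have lim1 : (psi x * (G m - G (c n)))%:E @[n --> \oo] --> (psi x * G m)%:E.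
  apply: cvg_EFin; first by near=> n.
  rewrite -[X in _ --> psi x * X]subr0; apply: cvgM; first exact: cvg_cst.
  by apply: cvgB; [exact: cvg_cst|exact: cvg_comp cb hlim].
have lim2 : (psi x * (G m - G (c n)))%:E @[n --> \oo] -->
    (\int[law x]_p (F y)^\+ p - \int[law x]_p (F y)^\- p)%E.
  under eq_fun do rewrite -diffE.
  rewrite FposE FnegE; apply: cvgeB => //.
  rewrite -FposE -FnegE.
  have pos0 : (0 <= \int[law x]_p (F y)^\+ p)%E by apply: integral_ge0.
  have neg0 : (0 <= \int[law x]_p (F y)^\- p)%E by apply: integral_ge0.
  by case: fin => ?; [apply: fin_num_adde_defr|apply: fin_num_adde_defl];
    rewrite ?fin_numN ge0_fin_numE.
exact: cvg_unique lim2 lim1.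
Unshelve. all: by end_near. Qed.

End representation.

(* The two sides integrate over different canonical measurable structures on the
   product, with the same measurable sets: that of [R] and that of
   [measurableTypeR R]. *)
Lemma integral_law_XT {R : realType} {d : measure_display} {Omega : measurableType d}
    (P : R -> probability Omega R) (r : R) (hr : 0 < r) (x : R)
    (f : Omega * measurableTypeR R -> \bar R) :
  measurable_fun setT f ->
  (\int[law_XT P r x]_p f p = \int[law_path_time P hr x]_p f p)%E.
Proof.
pose idf (p : Omega * measurableTypeR R) : Omega * R := p.
have midf : measurable_fun setT idf by move=> _ Y mY; rewrite setTI; exact: mY.
move=> mf.
pose pf : {measure set (Omega * R)%type -> \bar R} :=
  pushforward (law_path_time P hr x) idf.
pose m1 := pf midf.
have ge0 (h : Omega * R -> \bar R) : measurable_fun setT h -> (forall p, 0 <= h p)%E ->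
    (\int[m1]_p h p = \int[law_path_time P hr x]_p (h (idf p)))%E.
  move=> mh h0.
  exact: (ge0_integral_pushforward midf (law_path_time P hr x) measurableT mh).
transitivity (\int[m1]_p f p)%E; first by [].
rewrite [LHS]integralE [RHS]integralE; congr (_ - _)%E.
- by rewrite ge0//; exact: measurable_funepos.
- by rewrite ge0//; exact: measurable_funeneg.
Qed.

(* Used instead of [ge0_le_integral] because the functional composed with the shift
   [theta] is not known to be measurable. *)
Lemma le_nnintegral {d : measure_display} {T : measurableType d} {R : realType}
    (mu : {measure set T -> \bar R}) (D : set T) (f1 f2 : T -> \bar R) :
  (forall x, D x -> 0 <= f1 x)%E -> (forall x, D x -> f1 x <= f2 x)%E ->
  (\int[mu]_(x in D) f1 x <= \int[mu]_(x in D) f2 x)%E.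
Proof.
move=> f10 f12; rewrite ge0_integralE// ge0_integralE => [|x Dx]; last first.
  exact: le_trans (f10 x Dx) (f12 x Dx).
apply: ereal_sup_le => _ [h hf <-]; exists h => // x.
by apply: le_trans (hf x) _; exact: lee_restrict.
Qed.

(** * Shifted paths and the Markov property at a fixed time *)

Section shift.
Context {R : realType} {d : measure_display} {Omega : measurableType d}.
Variables (a b : \bar R) (mu sigma : R -> R) (X : R -> Omega -> R)
  (xi : Omega -> \bar R) (theta : R -> Omega -> Omega)
  (P : R -> probability Omega R).
Hypothesis hX : regular_diffusion a b mu sigma X xi theta P.
Implicit Types (w : Omega) (s t u : R).

Lemma alive_shift s t w : 0 <= s -> 0 <= t ->
  alive xi s (theta t w) <-> alive xi (s + t) w.
Proof.
move=> s0 t0; rewrite /alive/= (rd_shift_lifetime hX)// lt_max.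
by rewrite [X in _ || X]ltNge lee_fin s0 orbF lteBrDr// EFinD.
Qed.

Lemma running_sup_shift_le t u w : 0 <= t ->
  (running_sup X xi u (theta t w) <= running_sup X xi (t + u) w)%E.
Proof.
move=> t0; apply: running_sup_le => s /andP[s0 su] /(alive_shift _ s0 t0) sw.
rewrite (rd_shift hX)//; apply: running_sup_ge => //; first exact: addr_ge0.
by rewrite addrC lerD2l.
Qed.

Lemma running_sup_le_shift t u w : 0 <= t ->
  (running_sup X xi (t + u) w <=
   maxe (running_sup X xi t w) (running_sup X xi u (theta t w)))%E.
Proof.
move=> t0; apply: running_sup_le => s /andP[s0 su] sw; rewrite le_max.
have [st|ts] := leP s t; first by rewrite running_sup_ge.
have st0 : 0 <= s - t by rewrite subr_ge0 ltW.
have sE : s - t + t = s by rewrite subrK.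
apply/orP; right; rewrite -[in X in (X <= _)%E]sE -(rd_shift hX)// ?sE//.
apply: running_sup_ge => //; first by rewrite lerBlDl.
by apply/alive_shift => //; rewrite sE.
Qed.

Lemma deterministic_stopping_time t : 0 <= t -> stopping_time X xi (fun=> t%:E).
Proof.
move=> t0; split=> [w|s s0]; first by rewrite lee_fin.
have [ts|st] := ltP t s.
  rewrite (_ : [set _ | _] = setT); last first.
    by apply/seteqP; split => w //= _; rewrite lte_fin.
  exact: (@measurableT _ (g_sigma_algebraType (cylinders X xi [set u | u <= s]))).
rewrite (_ : [set _ | _] = set0); last first.
  by apply/seteqP; split => w //=; rewrite lte_fin ltNge st.
exact: (@measurable0 _ (g_sigma_algebraType (cylinders X xi [set u | u <= s]))).
Qed.

Lemma simple_markov t (eta : Omega -> \bar R) (x : R) : 0 <= t ->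
  measurable_fun setT eta -> (forall w, 0 <= eta w)%E -> state_space a b x ->
  (\int[P x]_(w in alive xi t) eta (theta t w) =
   \int[P x]_(w in alive xi t) \int[P (X t w)]_w' eta w')%E.
Proof.
move=> t0 meta eta0 xI.
have ht := deterministic_stopping_time t0.
have hT : stopped_event X xi (fun=> t%:E) setT.
  by move=> s s0; rewrite setTI; exact: ht.2.
have := rd_strong_markov hX ht hT meta eta0 xI.
by rewrite /= setTI.
Qed.

End shift.

(** * Excessivity of [V_y] *)

Section excessive.
Context {R : realType} {d : measure_display} {Omega : measurableType d}.
Variables (a b : \bar R) (mu sigma : R -> R) (X : R -> Omega -> R)
  (xi : Omega -> \bar R) (theta : R -> Omega -> Omega)
  (P : R -> probability Omega R).
Hypothesis hX : regular_diffusion a b mu sigma X xi theta P.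
Variables (r : R) (psi : R -> R).
Hypothesis hr : 0 < r.
Hypothesis hpsi : increasing_fundamental_solution a b mu sigma X xi P r psi.
Variables (xg : R) (S : seq R) (g : R -> R).
Hypothesis hg : admissible_payoff a b X xi P r xg S g.
Hypothesis hlim : g x / psi x @[x --> left_of b] --> (0 : R).
Variable (y : R).
Hypothesis yI : state_space a b y.
Hypothesis gy : 0 < g y.

Local Notation I := (state_space a b).
Local Notation f := (fhat S g psi).

Hypothesis f_ge0 : forall z, y <= z -> (z%:E < b)%E -> 0 <= f z.
Hypothesis f_homo : forall u v, y <= u -> u <= v -> (v%:E < b)%E -> f u <= f v.

Local Notation M := (running_sup X xi).
Local Notation F := (J_integrand b X xi f y).
Local Notation Vy := (V X xi P r g y).

Let J_integrandE w u : F (w, u) =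
  if (y%:E <= M u w < b)%E then f (fine (M u w)) else 0.
Proof.
rewrite /J_integrand/= indicE; case: ifPn => h; first by rewrite mem_set ?mulr1.
by rewrite memNset ?mulr0//; exact/negP.
Qed.

Let fin_sup w u : (y%:E <= M u w < b)%E -> M u w = (fine (M u w))%:E.
Proof.
by case: (M u w) => [s||] // /andP[_]; rewrite ltNge leey.
Qed.

Lemma J_integrand_ge0 p : 0 <= F p.
Proof.
case: p => w u; rewrite J_integrandE; case: ifPn => // h.
by move: (h); rewrite (fin_sup h) lee_fin => /andP[]; exact: f_ge0.
Qed.

(* The supremum of the shifted path can only leave [y, b) upwards through b, and
   then so does the full supremum, because the path stays below b while alive. *)
Lemma J_integrand_shift t u w : 0 <= t -> alive xi t w ->
  F (theta t w, u) <= F (w, t + u).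
Proof.
move=> t0 tw; rewrite [leLHS]J_integrandE.
case: ifPn => [h|_]; last exact: J_integrand_ge0.
have /andP[yN Nb] := h.
have NM := running_sup_shift_le hX u w t0.
have Mb : (M (t + u) w < b)%E.
  apply: le_lt_trans (running_sup_le_shift hX u w t0) _.
  by rewrite gt_max Nb andbT; exact: (running_sup_lt_b hX).
have h' : (y%:E <= M (t + u) w < b)%E by rewrite Mb (le_trans yN).
rewrite J_integrandE h'; apply: f_homo.
- by rewrite -lee_fin -(fin_sup h).
- by rewrite -lee_fin -(fin_sup h) -(fin_sup h').
- by rewrite -(fin_sup h').
Qed.

(** Averaging over [T] alone leaves a nonnegative functional of the path with expectation [V_y]; the
    Markov property is applied to it. *)
Let eta (w : Omega) : \bar R := (\int[exponential_law hr]_u (F (w, u))%:E)%E.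

Let mF : measurable_fun setT (fun p : Omega * measurableTypeR R => (F p)%:E).
Proof. exact: (measurable_J_integrand hX hr hpsi hg). Qed.

Let eta_ge0 w : (0 <= eta w)%E.
Proof. by apply: integral_ge0 => u _; rewrite lee_fin J_integrand_ge0. Qed.

Let measurable_eta : measurable_fun setT eta.
Proof.
apply: (measurable_fun_fubini_tonelli_F _ mF) => p.
by rewrite lee_fin J_integrand_ge0.
Qed.

Let integral_eta x : I x -> (\int[P x]_w eta w = Vy x)%E.
Proof.
move=> xI; rewrite (VE hX hr hpsi hg xI yI gy).
rewrite -(integral_J_integrand (hr := hr) hX hpsi hg hlim xI yI).
  rewrite fubini_tonelli1//.
  by move=> p; rewrite lee_fin J_integrand_ge0.
(* The negative part of the nonnegative integrand is zero, so the finiteness condition holds. *)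
right; rewrite (eq_integral (cst 0%E)) ?integral0 ?ltry// => p _.
rewrite funenegE -EFinN /= -EFin_max; apply/congr1/max_idPr.
by rewrite oppr_le0 J_integrand_ge0.
Qed.

Lemma V_supermartingale t x : 0 <= t -> I x ->
  (\int[P x]_(w in alive xi t) ((expR (- (r * t)))%:E * Vy (X t w)) <= Vy x)%E.
Proof.
move=> t0 xI; set c := expR _.
have c0 : 0 <= c by exact: expR_ge0.
pose ceta w : \bar R := (c%:E * eta w)%E.
have mceta : measurable_fun setT ceta by exact: measurable_funeM.
have ceta0 w : (0 <= ceta w)%E by rewrite mule_ge0.
have -> : (\int[P x]_(w in alive xi t) (c%:E * Vy (X t w)) =
    \int[P x]_(w in alive xi t) \int[P (X t w)]_w' ceta w')%E.
  apply: eq_integral => w; rewrite inE => tw.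
  rewrite -integral_eta ?ge0_integralZl//.
  exact: (rd_state hX).
rewrite -(simple_markov hX)// -integral_eta//.
apply: (@le_trans _ _ (\int[P x]_(w in alive xi t) eta w)%E); last first.
  by apply: ge0_subset_integral => //; exact: (measurable_alive hX).
(* The bound holds path by path: the shifted functional at [u] is at most the original one at
   [t + u], and memorylessness absorbs the factor [e^(-r t)]. *)
apply: le_nnintegral => // w tw; rewrite /ceta/=.
apply: (@le_trans _ _ (c%:E * \int[exponential_law hr]_u (F (w, t + u))%:E)%E).
  apply: lee_wpmul2l => //; apply: le_nnintegral => u _; rewrite lee_fin.
    exact: J_integrand_ge0.
  exact: J_integrand_shift.
apply: (@exponential_law_memoryless _ _ hr t (fun u => (F (w, u))%:E)) => //.
  apply: (measurableT_comp mF).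
  exact: measurable_fun_pair (measurable_cst _) (@measurable_id _ _ _).
by move=> u; rewrite lee_fin J_integrand_ge0.
Qed.

Let v z := psi z * (g (Num.max z y) / psi (Num.max z y)).

Let VyE z : I z -> Vy z = (v z)%:E.
Proof. by move=> zI; rewrite (VE hX hr hpsi hg zI yI gy). Qed.

Let v_ge0 z : I z -> 0 <= v z.
Proof.
move=> zI; have mI := state_space_max zI yI.
rewrite mulr_ge0 ?divr_ge0 ?ltW ?(ifs_gt0 hpsi)//.
exact: (payoff_gt0 hg).
Qed.

Let v_continuous z : I z -> {for z, continuous v}.
Proof.
move=> zI; apply: cvgM; first exact: (ifs_continuous hpsi zI).
apply: (@continuous_comp _ _ _ (fun z => Num.max z y) (fun z => g z / psi z)).
  by apply: continuous_max; [exact: cvg_id|exact: cvg_cst].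
exact: (payoff_ratio_continuous hpsi hg (state_space_max zI yI)).
Qed.

Lemma measurable_V : measurable_fun I Vy.
Proof.
apply: (eq_measurable_fun (EFin \o v)).
  by move=> z; rewrite inE => zI; rewrite VyE.
apply/measurable_EFinP; apply: open_continuous_measurable_fun.
  exact: open_state_space.
by move=> z; rewrite inE; exact: v_continuous.
Qed.

Let discounted t w : \bar R := ((expR (- (r * t)))%:E * Vy (X t w))%E.

Let measurable_discounted t : 0 <= t ->
  measurable_fun setT (discounted t \_ (alive xi t)).
Proof.
move=> t0; apply/(measurable_restrictT _ _).1; first exact: (measurable_alive hX).
apply: measurable_funeM; apply: (measurable_comp (F := I)) measurable_V _.
- exact: measurable_state_space.
- by move=> _ [w tw <-]; exact: (rd_state hX).
- exact: (measurable_position hX).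
Qed.

Let discounted_ge0 t w : 0 <= t -> (0 <= (discounted t \_ (alive xi t)) w)%E.
Proof.
move=> t0; apply: erestrict_ge0 => {}w tw; have XI := rd_state hX t0 tw.
by rewrite /discounted VyE// -EFinM lee_fin mulr_ge0 ?expR_ge0// v_ge0.
Qed.

(** A path alive at time 0 has positive lifetime, so it is eventually alive at [u n], and the limit
    follows from continuity of the path at 0 and of [v]. *)
Let discounted_cvg (u : nat -> R) x w : I x -> (forall n, 0 < u n) ->
  u n @[n --> \oo] --> 0 -> alive xi 0 w -> X 0 w = x ->
  (discounted (u n) \_ (alive xi (u n))) w @[n --> \oo] --> (v x)%:E.
Proof.
move=> xI u0 ucvg w0 Xx.
have uw : \forall n \near \oo, alive xi (u n) w.
  have [e e0 he] : exists2 e : R, 0 < e & (e%:E <= xi w)%E.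
    move: w0; rewrite /alive/=; case: (xi w) => [s||]//; last first.
      by exists 1; rewrite // leey.
    by rewrite lte_fin => s0; exists s.
  near=> n; apply: lt_le_trans he; rewrite lte_fin; near: n.
  exact: (cvgr_lt _ ucvg).
have Xu : X (u n) w @[n --> \oo] --> x.
  rewrite -Xx; apply: cvg_comp (path_cvg hX (lexx 0) w0).
  move=> A hA; suff : \forall n \near \oo, A (u n) by [].
  have {}hA : \forall n \near \oo, 0 <= u n /\ alive xi (u n) w -> A (u n) := ucvg _ hA.
  by apply: filterS2 uw hA => n nw; apply; split => //; exact: ltW.
have : (expR (- (r * u n)) * v (X (u n) w))%:E @[n --> \oo] --> (v x)%:E.
  apply: cvg_EFin; first by near=> n.
  rewrite -[X in _ --> X]mul1r; apply: cvgM.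
    rewrite -expR0; apply: continuous_cvg; first exact: continuous_expR.
    rewrite -oppr0 -(mulr0 r); apply: cvgN; apply: cvgM => //; exact: cvg_cst.
  exact: (continuous_cvg _ (v_continuous xI) Xu).
apply: cvg_trans; apply: near_eq_cvg; apply: filterS uw => n nw.
rewrite patchE mem_set// /discounted VyE -?EFinM//.
by apply: (rd_state hX) => //; exact: ltW.
Unshelve. all: by end_near. Qed.

(** Fatou's lemma bounds the lower limit from below, and [V_supermartingale] bounds every term from
    above, so no dominating function is needed. *)
Lemma V_right_continuous x : I x ->
  (\int[P x]_(w in alive xi t) ((expR (- (r * t)))%:E * Vy (X t w)))%E
    @[t --> 0^'+] --> Vy x.
Proof.
move=> xI; rewrite VyE//; apply/cvge_at_rightP => u [u0 ucvg].
pose h n w := (discounted (u n) \_ (alive xi (u n))) w.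
have hE n : (\int[P x]_(w in alive xi (u n))
      ((expR (- (r * u n)))%:E * Vy (X (u n) w)) =
    \int[P x]_w h n w)%E by rewrite integral_mkcond.
have mh n : measurable_fun setT (h n) by apply: measurable_discounted; exact: ltW.
have h0 n w : (0 <= h n w)%E by apply: discounted_ge0; exact: ltW.
pose A0 : set Omega := alive xi 0 `&` X 0 @^-1` [set x].
have mA0 : measurable A0 by exact: (measurable_started hX).
have le_h n : (\int[P x]_w h n w <= (v x)%:E)%E.
  by rewrite -hE -VyE//; apply: V_supermartingale => //; exact: ltW.
have ge_h : ((v x)%:E <= limn_einf (fun n => \int[P x]_w h n w))%E.
  (* Pointwise convergence is known only for paths started at [x]. Fatou is applied on that event of
     probability one, and nonnegativity extends the bound to the whole space. *)
  apply: (@le_trans _ _ (limn_einf (fun n => \int[P x]_(w in A0) h n w)))%E.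
    apply: le_trans (fatou (P x) mA0 _ _) => //; last first.
      by move=> n; exact: measurable_funTS.
    rewrite (eq_integral (cst (v x)%:E)) ?integral_cst//.
      by rewrite [X in (_ * X)%E](_ : _ = 1%E) ?mule1//; exact: (rd_start hX).
    move=> w; rewrite inE => -[w0 Xx].
    by rewrite (cvg_limn_einf_sup (discounted_cvg xI u0 ucvg w0 Xx)).1.
  rewrite !limn_einf_lim; apply: lee_lim; try exact: is_cvg_einfs.
  apply: nearW => n; apply: le_ereal_inf_tmp => _ [k nk <-].
  apply: (@le_trans _ _ (\int[P x]_(w in A0) h k w)%E).
    by apply: ereal_inf_lbound; exists k.
  by apply: ge0_subset_integral.
under eq_fun do rewrite hE.
(* The tail infima of [H] tend to its lower limit [v x]; together with the constant upper bound they
   squeeze [H]. *)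
pose H n := (\int[P x]_w h n w)%E.
have einfs_le n : (einfs H n <= H n)%E by apply: ereal_inf_lbound; exists n => /=.
have einfs_cvg : einfs H @ \oo --> (v x)%:E.
  suff -> : (v x)%:E = limn_einf H by rewrite limn_einf_lim; exact: is_cvg_einfs.
  apply/eqP; rewrite eq_le ge_h/= limn_einf_lim; apply: lime_le.
    exact: is_cvg_einfs.
  by apply: nearW => n; exact: le_trans (einfs_le n) (le_h n).
apply: squeeze_cvge einfs_cvg (@cvg_cst _ (v x)%:E _ _ _).
by apply: nearW => n; rewrite einfs_le le_h.
Qed.

Lemma V_excessive : excessive a b X xi P r Vy.
Proof.
split.
- exact: measurable_V.
- by move=> x xI; rewrite VyE// lee_fin v_ge0.
- by move=> t x; exact: V_supermartingale.
- exact: V_right_continuous.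
Qed.

End excessive.

Theorem theorem3p4 (R : realType) (d : measure_display) (Omega : measurableType d)
    (a b : \bar R) (mu sigma : R -> R)
    (X : R -> Omega -> R) (xi : Omega -> \bar R) (theta : R -> Omega -> Omega)
    (P : R -> probability Omega R)
    (hX : regular_diffusion a b mu sigma X xi theta P)
    (r : R) (hr : 0 < r)
    (psi : R -> R)
    (hpsi : increasing_fundamental_solution a b mu sigma X xi P r psi)
    (xg : R) (S : seq R) (g : R -> R)
    (hg : admissible_payoff a b X xi P r xg S g)
    (y : R) (hy : state_space a b y) (hgy : 0 < g y)
    (hlim : g x / psi x @[x --> left_of b] --> (0 : R)) :
  (forall x, state_space a b x ->
    [/\ cvg (J_partial (fhat S g psi) psi y x c @[c --> left_of b]),
        (J b (fhat S g psi) psi y x)%:E = V X xi P r g y x &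
        let F := fun p => (J_integrand b X xi (fhat S g psi) y p)%:E in
        (\int[law_XT P r x]_p (F^\+ p) < +oo \/ \int[law_XT P r x]_p (F^\- p) < +oo)%E ->
        (\int[law_XT P r x]_p F p = (J b (fhat S g psi) psi y x)%:E)%E]) /\
  ((forall z, y <= z -> (z%:E < b)%E -> 0 <= fhat S g psi z) ->
   (forall u v, y <= u -> u <= v -> (v%:E < b)%E ->
      fhat S g psi u <= fhat S g psi v) ->
   lower_semicontinuous
     (fun z : subspace [set z : R | y <= z /\ (z%:E < b)%E] =>
        (payoff_derive S g z)%:E) ->
   excessive a b X xi P r (V X xi P r g y)).
Proof.
have cvgJ := J_partial_cvg hX hr hpsi hg hlim.
have JE := JE hX hr hpsi hg hlim.
split=> [x xI|f_ge0 f_homo _]; last exact: (V_excessive hX hr hpsi hg hlim hy hgy).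
split.
- by apply/cvg_ex; eexists; exact: cvgJ.
- by rewrite JE// (VE hX hr hpsi hg).
- move=> F.
  have mF := measurable_J_integrand hX hr hpsi hg hy.
  rewrite JE// (integral_law_XT P hr x mF).
  rewrite (integral_law_XT P hr x (measurable_funepos mF)).
  rewrite (integral_law_XT P hr x (measurable_funeneg mF)).
  exact: (integral_J_integrand (hr := hr) hX hpsi hg hlim xI hy).
Qed.
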